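(* Let $p=p_n\in(0,1)$ and let $x=x_n$ be non-negative integers such that, as $n\to\infty$, $p\to0$, $np\to\infty$ and $|x-np^2|=o\big(\min(np^2,\,n^{2/3}p^{2/3})\big)$. Then $$\frac{P(S_\xi=x)}{\mathrm{NB}(r,\bar q)\{x\}}=1+o(1)\quad(n\to\infty).$$
   Context: $\eta_1,\dots,\eta_{n+1}$ are i.i.d. Bernoulli random variables with $P(\eta_1=1)=p=1-P(\eta_1=0)$; $\xi_i=\eta_i\eta_{i+1}$ and $S_\xi=\xi_1+\dots+\xi_n$ (the 2-runs statistic). The negative binomial distribution is $\mathrm{NB}(r,\bar q)\{j\}=\frac{\Gamma(r+j)}{j!\,\Gamma(r)}\bar q^r\bar p^j$, $j=0,1,2,\dots$, where $\bar q+\bar p=1$, with parameters $$\bar p=\frac{np^3(2-3p)-2p^3(1-p)}{np^2+np^3(2-3p)-2p^3(1-p)},\qquad r=\frac{n^2p^4}{np^3(2-3p)-2p^3(1-p)}.$$ *)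

(* Defs.v *)
From Stdlib Require Import Reals List Arith.
Import ListNotations.
Open Scope R_scope.

Fixpoint bool_lists (m : nat) : list (list bool) :=
  match m with
  | O => [ [] ]
  | S k => map (cons true) (bool_lists k) ++ map (cons false) (bool_lists k)
  end.

Fixpoint outcome_prob (p : R) (l : list bool) : R :=
  match l with
  | [] => 1
  | b :: t => (if b then p else 1 - p) * outcome_prob p t
  end.

Fixpoint runs2 (l : list bool) : nat :=
  match l with
  | a :: ((b :: _) as t) => ((if andb a b then 1 else 0) + runs2 t)%nat
  | _ => O
  end.

Definition P_S2 (n : nat) (p : R) (x : nat) : R :=
  fold_right Rplus 0
    (map (outcome_prob p)
       (filter (fun l => Nat.eqb (runs2 l) x) (bool_lists (S n)))).

(* Rising factorial r (r+1) ... (r+j-1) = Gamma(r+j)/Gamma(r) for r > 0. *)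
Fixpoint rising (r : R) (j : nat) : R :=
  match j with
  | O => 1
  | S k => rising r k * (r + INR k)
  end.

(* NB(r, qbar){j} with qbar = 1 - pbar. *)
Definition NB (r pbar : R) (j : nat) : R :=
  rising r j / INR (fact j) * Rpower (1 - pbar) r * pbar ^ j.

Definition NB_denom_part (n : nat) (p : R) : R :=
  INR n * p ^ 3 * (2 - 3 * p) - 2 * p ^ 3 * (1 - p).

Definition pbar_par (n : nat) (p : R) : R :=
  NB_denom_part n p / (INR n * p ^ 2 + NB_denom_part n p).

Definition r_par (n : nat) (p : R) : R :=
  (INR n) ^ 2 * p ^ 4 / NB_denom_part n p.

(* Main.v *)
Require Import Defs.
From Stdlib Require Import Reals List Arith Bool Lra Lia Psatz.
From Coquelicot Require Import Coquelicot.
Import ListNotations.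
Open Scope R_scope.

(* Write [f j = P(S = j)] and [lam = n p^2].  Splitting [f j] by the number [m] of
   blocks of ones gives explicit products of two binomials, whose ratios in [j] and
   in [m] are rational.  The ratio in [m] yields a Stein identity for the law of [m]
   given [S = j]: it concentrates within [sqrt (n p)] of an explicit point and its
   mean is within [O(1)] of it.  Averaging the ratio in [j] over that law then gives
     [(j + 1) f (j + 1) / f j = lam + (j - lam) c + O(p + (j - lam)^2 / n)],
   where the negative binomial satisfies the same recursion without error, up to a
   negligible change of [c].  So [f / NB] varies by a factor [1 + o(1)] over all [j]
   with [|j - lam| = o((n p)^(2/3))], a range containing a window of many standard
   deviations.  Both laws have mean [lam] and the same variance, so by Chebyshev both
   give this window mass close to one, which forces the ratio to be close to one. *)


(** Where the exponent 2/3 comes from: after division by [lam], one step at distance [t = j - lam]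
    carries a relative error of order [1/(n p) + t^2/(n p)^2]. Over [T] steps this adds up to
    [T/(n p) + T^3/(n p)^2], which is small when [T = o((n p)^(2/3))]. This also explains why the
    mean of [m] must be located within O(1): an error of the size of its spread [sqrt (n p)] would
    cost [(n p)^(-1/2)] per step, too much over so many steps.

    Only [n p] is known to tend to infinity; [lam] may stay bounded, so neither law need be close to
    a Gaussian. The argument therefore uses nothing but ratios and second moments, and never
    evaluates a factorial asymptotically. The standard deviation is still negligible against the
    range of slow variation, because [sqrt lam / (n p)^(2/3) = sqrt p * (n p)^(-1/6)]. *)

(** * Binomial coefficients *)

Fixpoint binom (n k : nat) : R :=
  match n, k with
  | _, O => 1
  | O, S _ => 0
  | S n', S k' => binom n' k' + binom n' (S k')
  end.

Lemma binom_0_r n : binom n 0 = 1.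
Proof. destruct n; reflexivity. Qed.

Lemma binom_nonneg n k : 0 <= binom n k.
Proof.
  revert k; induction n as [|n IH]; intros [|k]; simpl; try lra.
  pose proof (IH k); pose proof (IH (S k)); lra.
Qed.

Lemma binom_gt n k : (n < k)%nat -> binom n k = 0.
Proof.
  revert k; induction n as [|n IH]; intros [|k] H; simpl; try lia; try lra.
  rewrite (IH k), (IH (S k)) by lia; lra.
Qed.

Lemma binom_diag n : binom n n = 1.
Proof.
  induction n as [|n IH]; simpl; [reflexivity|].
  rewrite IH, (binom_gt n (S n)) by lia; lra.
Qed.

(** The real difference [INR n - INR k] keeps the identity valid for every [k]: it vanishes at
    [k = n], and beyond that both binomials do. *)
Lemma binom_succ_r n k :
  INR (S k) * binom n (S k) = (INR n - INR k) * binom n k.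
Proof.
  revert k; induction n as [|n IH]; intros k.
  - destruct k; simpl; ring.
  - destruct k as [|k].
    + simpl binom. specialize (IH O). rewrite binom_0_r in *.
      rewrite !S_INR in *. change (INR 0) with 0 in *. lra.
    + simpl binom. pose proof (IH k) as H1. pose proof (IH (S k)) as H2.
      rewrite !S_INR in *. nra.
Qed.

Lemma binom_succ_l n k :
  (INR n + 1 - INR k) * binom (S n) k = (INR n + 1) * binom n k.
Proof.
  destruct k as [|k]; simpl binom.
  - rewrite binom_0_r; simpl INR; ring.
  - pose proof (binom_succ_r n k) as H. rewrite S_INR in *. nra.
Qed.

(** * Law and first two moments of the 2-runs statistic *)

(* [run_exp p b N phi] is the expectation of [phi (runs2 (b :: l))] when [l] has
   [N] independent Bernoulli([p]) entries. *)
Fixpoint run_exp (p : R) (b : bool) (N : nat) (phi : nat -> R) : R :=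
  match N with
  | O => phi O
  | S k => p * run_exp p true k (if b then fun s => phi (S s) else phi)
           + (1 - p) * run_exp p false k phi
  end.

Definition indic (x s : nat) : R := if Nat.eqb s x then 1 else 0.

Lemma run_exp_ext p N : forall b phi psi,
  (forall s, (s <= N)%nat -> phi s = psi s) ->
  run_exp p b N phi = run_exp p b N psi.
Proof.
  induction N as [|N IH]; intros b phi psi H; simpl.
  - apply H; lia.
  - f_equal; f_equal; apply IH; intros s Hs.
    + destruct b; apply H; lia.
    + apply H; lia.
Qed.

Lemma run_exp_plus p N : forall b phi psi,
  run_exp p b N (fun s => phi s + psi s) = run_exp p b N phi + run_exp p b N psi.
Proof.
  induction N as [|N IH]; intros b phi psi; simpl; [ring|].
  rewrite IH. destruct b; rewrite IH; ring.
Qed.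

Lemma run_exp_scal p c N : forall b phi,
  run_exp p b N (fun s => c * phi s) = c * run_exp p b N phi.
Proof.
  induction N as [|N IH]; intros b phi; simpl; [ring|].
  rewrite IH. destruct b; rewrite IH; ring.
Qed.

Lemma run_exp_const p c N : forall b, run_exp p b N (fun _ => c) = c.
Proof.
  induction N as [|N IH]; intros b; simpl; [ring|].
  rewrite IH. destruct b; rewrite IH; ring.
Qed.

Lemma sum_indic psi J s :
  sum_f_R0 (fun j => psi j * indic j s) J = if Nat.leb s J then psi s else 0.
Proof.
  unfold indic. induction J as [|J IH]; simpl sum_f_R0.
  - destruct s; simpl; ring.
  - rewrite IH.
    destruct (Nat.leb_spec s J), (Nat.leb_spec s (S J)), (Nat.eqb_spec s (S J));
      try lia; subst; ring.
Qed.

(** Links expectations computed by conditioning with sums of point probabilities. [N] trials after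
    the first entry create at most [N] pairs, so any [J >= N] covers the support. *)
Lemma run_exp_sum p b N psi J : (N <= J)%nat ->
  sum_f_R0 (fun j => psi j * run_exp p b N (indic j)) J = run_exp p b N psi.
Proof.
  intros HJ.
  transitivity (run_exp p b N (fun s => sum_f_R0 (fun j => psi j * indic j s) J)).
  - clear HJ. induction J as [|J IH]; simpl sum_f_R0.
    + now rewrite run_exp_scal.
    + now rewrite run_exp_plus, run_exp_scal, IH.
  - apply run_exp_ext; intros s Hs. rewrite sum_indic.
    destruct (Nat.leb_spec s J); [reflexivity|lia].
Qed.

(** Both starts are treated at once because conditioning on a trial mixes them. A start from a one
    adds only the pair formed with the first trial, hence the extra [p]. *)
Lemma run_exp_id p n :
  run_exp p false (S n) INR = INR n * p ^ 2 /\
  run_exp p true (S n) INR = INR n * p ^ 2 + p.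
Proof.
  assert (E : forall k, run_exp p true k (fun s => INR (S s)) = run_exp p true k INR + 1).
  { intros k. rewrite (run_exp_ext p k true _ (fun s => INR s + 1)).
    - now rewrite run_exp_plus, run_exp_const.
    - intros s _; apply S_INR. }
  induction n as [|n [IH1 IH2]].
  - simpl; split; ring.
  - split.
    + transitivity (p * run_exp p true (S n) INR + (1 - p) * run_exp p false (S n) INR);
        [reflexivity|]. rewrite IH1, IH2, S_INR; ring.
    + transitivity (p * run_exp p true (S n) (fun s => INR (S s))
                    + (1 - p) * run_exp p false (S n) INR);
        [reflexivity|]. rewrite E, IH1, IH2, S_INR; ring.
Qed.

(** [NB_denom_part] enters as the excess of the variance over the mean. The last summand compares
    the two starts: with probability [p] the count grows by one, and the remaining count then has
    mean [n p^2 + p]. *)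
Lemma run_exp_sqr p n :
  run_exp p false (S (S n)) (fun s => INR s ^ 2)
    = (INR (S n) * p ^ 2) ^ 2 + INR (S n) * p ^ 2 + NB_denom_part (S n) p /\
  run_exp p true (S (S n)) (fun s => INR s ^ 2)
    = (INR (S n) * p ^ 2) ^ 2 + INR (S n) * p ^ 2 + NB_denom_part (S n) p
      + p * (2 * (INR n * p ^ 2 + p) + 1).
Proof.
  set (sq := fun s => INR s ^ 2).
  assert (E : forall k, run_exp p true k (fun s => sq (S s))
                        = run_exp p true k sq + (2 * run_exp p true k INR + 1)).
  { intros k. rewrite (run_exp_ext p k true _ (fun s => sq s + (2 * INR s + 1))).
    - now rewrite run_exp_plus, run_exp_plus, run_exp_scal, run_exp_const.
    - intros s _; unfold sq; rewrite S_INR; ring. }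
  induction n as [|n [IH1 IH2]].
  - unfold NB_denom_part, sq; simpl; split; ring.
  - pose proof (proj2 (run_exp_id p (S n))) as H1.
    split.
    + transitivity (p * run_exp p true (S (S n)) sq + (1 - p) * run_exp p false (S (S n)) sq);
        [reflexivity|]. rewrite IH1, IH2. unfold NB_denom_part. rewrite !S_INR. ring.
    + transitivity (p * run_exp p true (S (S n)) (fun s => sq (S s))
                    + (1 - p) * run_exp p false (S (S n)) sq);
        [reflexivity|]. rewrite E, H1, IH1, IH2. unfold NB_denom_part. rewrite !S_INR. ring.
Qed.

Lemma runs_variance p n : (1 <= n)%nat ->
  run_exp p false (S n) (fun s => (INR s - INR n * p ^ 2) ^ 2)
  = INR n * p ^ 2 + NB_denom_part n p.
Proof.
  destruct n as [|n]; [lia|]; intros _.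
  set (lam := INR (S n) * p ^ 2).
  rewrite (run_exp_ext _ _ _ _ (fun s => INR s ^ 2 + ((- 2 * lam) * INR s + lam ^ 2))).
  - rewrite run_exp_plus, run_exp_plus, run_exp_scal, run_exp_const.
    rewrite (proj1 (run_exp_sqr p n)), (proj1 (run_exp_id p (S n))).
    fold lam. ring.
  - intros s _; ring.
Qed.

Lemma fold_right_Rplus_app l1 l2 :
  fold_right Rplus 0 (l1 ++ l2) = fold_right Rplus 0 l1 + fold_right Rplus 0 l2.
Proof. induction l1 as [|a l IH]; simpl; [|rewrite IH]; ring. Qed.

Lemma runs2_cons b l :
  runs2 (b :: l) = ((if andb b (hd false l) then 1 else 0) + runs2 l)%nat.
Proof. destruct l as [|c l]; simpl; [now rewrite andb_false_r|reflexivity]. Qed.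

Lemma list_exp_run_exp p N : forall b phi,
  fold_right Rplus 0 (map (fun l => outcome_prob p l * phi (runs2 (b :: l))) (bool_lists N))
  = run_exp p b N phi.
Proof.
  induction N as [|N IH]; intros b phi.
  - simpl; ring.
  - simpl bool_lists. rewrite map_app, !map_map, fold_right_Rplus_app.
    simpl run_exp. rewrite <- (IH true), <- (IH false).
    assert (sc : forall c (g : list bool -> R) ls,
      fold_right Rplus 0 (map (fun l => c * g l) ls) = c * fold_right Rplus 0 (map g ls)).
    { intros c g ls; induction ls as [|a ls IHl]; simpl; [|rewrite IHl]; ring. }
    rewrite <- !sc. f_equal; f_equal; apply map_ext; intros l.
    + rewrite (runs2_cons b). destruct b; simpl hd; simpl outcome_prob;
        [replace (1 + runs2 (true :: l))%nat with (S (runs2 (true :: l))) by reflexivity|];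
        cbn [andb Nat.add]; ring.
    + rewrite (runs2_cons b). simpl hd. rewrite andb_false_r. cbn [Nat.add]. simpl outcome_prob. ring.
Qed.

(** A fictitious zero in front of the [S n] trials forms no pair, so the count is unchanged. *)
Lemma P_S2_run_exp n p x : P_S2 n p x = run_exp p false (S n) (indic x).
Proof.
  rewrite <- list_exp_run_exp. unfold P_S2.
  induction (bool_lists (S n)) as [|l ls IH]; [reflexivity|].
  rewrite (map_cons _ l ls). cbn [filter fold_right]. rewrite <- IH.
  rewrite (runs2_cons false). cbn [andb Nat.add]. unfold indic.
  destruct (Nat.eqb (runs2 l) x); simpl; ring.
Qed.

(** * Decomposition by the number of blocks of ones *)

(* [block_term p N x m] is the probability that [N] Bernoulli([p]) trials form
   [m] blocks of ones with [x] adjacent pairs of ones, hence [x + m] ones: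
   [binom (x + m - 1) x] counts the block lengths and the other binomial the
   positions of the blocks among the zeros. *)
Definition block_term (p : R) (N x m : nat) : R :=
  if Nat.leb (x + m) N then
    binom (x + m - 1) x * binom (S N - x - m) m * p ^ (x + m) * (1 - p) ^ (N - x - m)
  else 0.

(* The same for the [N] trials that follow an initial one; that one's block is
   not counted by [m]. *)
Definition block_term1 (p : R) (N x m : nat) : R :=
  if Nat.leb (x + m) N then
    binom (x + m) x * binom (N - x - m) m * p ^ (x + m) * (1 - p) ^ (N - x - m)
  else 0.

Lemma block_term_succ_0 p N x :
  block_term p (S N) x 0 = (1 - p) * block_term p N x 0.
Proof.
  unfold block_term. rewrite !Nat.add_0_r, !Nat.sub_0_r.
  destruct (Nat.leb_spec x (S N)), (Nat.leb_spec x N); try lia; rewrite ?binom_0_r.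
  - replace (S N - x)%nat with (S (N - x)) by lia. simpl pow. ring.
  - rewrite binom_gt by lia. ring.
  - ring.
Qed.

(** Conditioning on the first trial: a one opens a block that [block_term1] no longer counts.
    Algebraically this is Pascal's rule for the binomial that places the blocks. *)
Lemma block_term_succ_S p N x m :
  block_term p (S N) x (S m)
  = p * block_term1 p N x m + (1 - p) * block_term p N x (S m).
Proof.
  unfold block_term, block_term1.
  destruct (Nat.leb_spec (x + S m) (S N)), (Nat.leb_spec (x + m) N),
    (Nat.leb_spec (x + S m) N); try lia.
  - replace (x + S m - 1)%nat with (x + m)%nat by lia.
    replace (S (S N) - x - S m)%nat with (S (N - x - m)) by lia.
    replace (S N - x - S m)%nat with (N - x - m)%nat by lia.
    replace (x + S m)%nat with (S (x + m)) by lia.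
    replace (N - x - m)%nat with (S (N - x - S m)) by lia.
    cbn [binom pow]. ring.
  - replace (x + S m - 1)%nat with (x + m)%nat by lia.
    replace (S (S N) - x - S m)%nat with 1%nat by lia.
    replace (S N - x - S m)%nat with 0%nat by lia.
    replace (N - x - m)%nat with 0%nat by lia.
    replace (x + S m)%nat with (S (x + m)) by lia.
    destruct m; cbn [binom pow]; ring.
  - ring.
Qed.

(** After an initial one, a further one adds a pair to its block and a zero closes it. This is
    Pascal's rule for the binomial of block lengths. *)
Lemma block_term1_succ p N x m :
  block_term1 p (S N) (S x) m
  = p * block_term1 p N x m + (1 - p) * block_term p N (S x) m.
Proof.
  unfold block_term, block_term1.
  destruct (Nat.leb_spec (S x + m) (S N)), (Nat.leb_spec (x + m) N),
    (Nat.leb_spec (S x + m) N); try lia.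
  - replace (S x + m - 1)%nat with (x + m)%nat by lia.
    replace (S N - S x - m)%nat with (N - x - m)%nat by lia.
    replace (N - x - m)%nat with (S (N - S x - m)) by lia.
    replace (S x + m)%nat with (S (x + m)) by lia.
    cbn [binom pow]. ring.
  - replace (S N - S x - m)%nat with 0%nat by lia.
    replace (N - x - m)%nat with 0%nat by lia.
    replace (S x + m)%nat with (S (x + m)) by lia.
    destruct m; cbn [binom pow]; [|ring].
    rewrite Nat.add_0_r, (binom_gt x (S x)) by lia. ring.
  - ring.
Qed.

Lemma block_term1_succ_0 p N m :
  block_term1 p (S N) 0 m = (1 - p) * block_term p N 0 m.
Proof.
  unfold block_term, block_term1. cbn [Nat.add]. rewrite !Nat.sub_0_r, !binom_0_r.
  destruct (Nat.leb_spec m (S N)), (Nat.leb_spec m N); try lia.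
  - replace (S N - m)%nat with (S (N - m)) by lia. simpl pow. ring.
  - replace (S N - m)%nat with 0%nat by lia. destruct m; [lia|]. simpl. ring.
  - ring.
Qed.

Lemma block_term_0 p N x m : (N < m)%nat -> block_term p N x m = 0.
Proof. intros H; unfold block_term. destruct (Nat.leb_spec (x + m) N); [lia|reflexivity]. Qed.

Lemma block_term1_0 p N x m : (N < m)%nat -> block_term1 p N x m = 0.
Proof. intros H; unfold block_term1. destruct (Nat.leb_spec (x + m) N); [lia|reflexivity]. Qed.

Lemma sum_scal_l c g M :
  sum_f_R0 (fun i => c * g i) M = c * sum_f_R0 g M.
Proof. rewrite scal_sum. apply sum_eq; intros; ring. Qed.

(** The upper limit [M] is free so that the sums for [N] and [S N] in the induction share a
    range. *)
Lemma run_exp_blocks p N : forall x M, (N <= M)%nat ->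
  run_exp p false N (indic x) = sum_f_R0 (block_term p N x) M /\
  run_exp p true N (indic x) = sum_f_R0 (block_term1 p N x) M.
Proof.
  induction N as [|N IH]; intros x M HM.
  - assert (E : forall g : nat -> R, (forall m, (0 < m)%nat -> g m = 0) -> sum_f_R0 g M = g O).
    { intros g Hg. clear HM. induction M as [|M IHM]; simpl; [reflexivity|].
      rewrite IHM, (Hg (S M)) by lia; ring. }
    rewrite !E.
    + unfold block_term, block_term1, indic; destruct x; simpl; split; ring.
    + intros; now apply block_term1_0.
    + intros; now apply block_term_0.
  - split.
    + transitivity (p * run_exp p true N (indic x) + (1 - p) * run_exp p false N (indic x));
        [reflexivity|].
      rewrite (proj1 (IH x M ltac:(lia))).
      destruct M as [|M]; [lia|].
      rewrite (proj2 (IH x M ltac:(lia))).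
      rewrite (decomp_sum (block_term p (S N) x)) by lia.
      rewrite (decomp_sum (block_term p N x)) by lia. simpl pred.
      rewrite block_term_succ_0.
      rewrite (sum_eq _ _ _ (fun i _ => block_term_succ_S p N x i)).
      rewrite plus_sum, !sum_scal_l. ring.
    + transitivity (p * run_exp p true N (fun s => indic x (S s))
                    + (1 - p) * run_exp p false N (indic x)); [reflexivity|].
      rewrite (proj1 (IH x M ltac:(lia))).
      destruct x as [|x].
      * rewrite (run_exp_ext p N true _ (fun _ => 0)) by reflexivity.
        rewrite run_exp_const.
        rewrite (sum_eq _ _ _ (fun i _ => block_term1_succ_0 p N i)).
        rewrite sum_scal_l. ring.
      * rewrite (run_exp_ext p N true _ (indic x)) by reflexivity.
        rewrite (proj2 (IH x M ltac:(lia))).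
        rewrite (sum_eq _ _ _ (fun i _ => block_term1_succ p N x i)).
        rewrite plus_sum, !sum_scal_l. ring.
Qed.

Lemma binom_absorb n k : INR (S k) * binom (S n) (S k) = INR (S n) * binom n k.
Proof.
  simpl binom. pose proof (binom_succ_r n k) as H. rewrite !S_INR in *. nra.
Qed.

Lemma block_term_nonneg p N x m : 0 <= p <= 1 -> 0 <= block_term p N x m.
Proof.
  intros Hp; unfold block_term. destruct (Nat.leb (x + m) N); [|lra].
  repeat apply Rmult_le_pos; try apply binom_nonneg; apply pow_le; lra.
Qed.

(** [m] blocks contain [x + m] ones and need at least [m - 1] separating zeros. *)
Lemma block_term_support p N x m : block_term p N x m <> 0 ->
  (x + m <= N)%nat /\ (2 * m <= N - x + 1)%nat /\ (m = O -> x = O).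
Proof.
  unfold block_term. destruct (Nat.leb_spec (x + m) N) as [H|H]; [|now intros []].
  intros Hn. repeat split; [exact H| |].
  - destruct (le_lt_dec m (S N - x - m)) as [H1|H1]; [lia|].
    exfalso; apply Hn. rewrite (binom_gt (S N - x - m) m H1). ring.
  - intros ->. destruct x as [|x]; [reflexivity|].
    exfalso; apply Hn. rewrite (binom_gt (S x + 0 - 1)) by lia. ring.
Qed.

Lemma block_term_1_pos p N x : 0 < p < 1 -> (S x <= N)%nat -> 0 < block_term p N x 1.
Proof.
  intros Hp H. unfold block_term.
  destruct (Nat.leb_spec (x + 1) N); [|lia].
  replace (x + 1 - 1)%nat with x by lia.
  replace (S N - x - 1)%nat with (S (N - x - 1)) by lia.
  rewrite binom_diag. simpl binom. rewrite binom_0_r.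
  pose proof (binom_nonneg (N - x - 1) 1).
  assert (0 < p ^ (x + 1)) by (apply pow_lt; lra).
  assert (0 < (1 - p) ^ (N - x - 1)) by (apply pow_lt; lra).
  repeat apply Rmult_lt_0_compat; lra.
Qed.

(* For [x + m > 1] this is [m (m - 1) / (x + m - 1)]; the subtractive form also
   gives the right value [m] when [x = 0], where Rocq's [0 / 0] is [0]. *)
Definition block_rate (X m : R) : R := m - X * m / (X + m - 1).

(** The ratio of consecutive terms in [m], cross-multiplied so that it survives at the edge of the
    support, where both sides are 0. *)
Lemma block_term_succ_blocks p N x m :
  let L := INR N - INR x in
  block_term p N x (S m)
    * ((1 - p) * block_rate (INR x) (INR (S m)) * (L - INR (S m) + 2))
  = block_term p N x m * (p * (L - 2 * INR m + 1) * (L - 2 * INR m)).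
Proof.
  intros L; subst L. unfold block_term.
  destruct (Nat.leb_spec (x + S m) N), (Nat.leb_spec (x + m) N); try lia; [| |ring].
  - replace (x + S m - 1)%nat with (x + m)%nat by lia.
    replace (S N - x - S m)%nat with (N - x - m)%nat by lia.
    replace (S N - x - m)%nat with (S (N - x - m)) by lia.
    remember (N - x - S m)%nat as Z eqn:EZ.
    replace (N - x - m)%nat with (S Z) by lia.
    assert (EN : INR N - INR x = INR (S Z) + INR m).
    { replace N with (x + (S Z + m))%nat by lia. rewrite !plus_INR. ring. }
    rewrite EN.
    replace (x + S m)%nat with (S (x + m)) by lia.
    pose proof (binom_succ_r (S Z) m) as B1.
    pose proof (binom_succ_l (S Z) m) as B2.
    set (z := INR (S Z)) in *.
    assert (B3 : binom (x + m) x * block_rate (INR x) (INR (S m))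
                 = binom (x + m - 1) x * INR (S m)).
    { unfold block_rate. destruct (Nat.eq_dec (x + m) 0) as [E|E].
      - assert (x = O) by lia. assert (m = O) by lia. subst. simpl. unfold Rdiv; ring.
      - pose proof (binom_succ_l (x + m - 1) x) as B.
        replace (S (x + m - 1)) with (x + m)%nat in B by lia.
        assert (E1 : INR (x + m - 1) + 1 = INR x + INR m).
        { rewrite <- S_INR, <- plus_INR. f_equal. lia. }
        rewrite E1 in B.
        assert (0 < INR x + INR m) by (rewrite <- plus_INR; apply lt_0_INR; lia).
        assert (E2 : binom (x + m - 1) x = INR m * binom (x + m) x / (INR x + INR m)).
        { replace (INR m) with (INR x + INR m - INR x) at 1 by ring. rewrite B. field. lra. }
        rewrite E2, !S_INR. field. lra. }
    transitivity (binom (x + m) x * block_rate (INR x) (INR (S m))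
       * (binom (S Z) (S m) * (z + INR m - INR (S m) + 2)) * p ^ S (x + m) * (1 - p) ^ S Z);
      [simpl pow; ring|].
    rewrite B3. rewrite S_INR in *.
    replace (z + INR m - (INR m + 1) + 2) with (z + 1) by ring.
    transitivity (binom (x + m - 1) x * (((INR m + 1) * binom (S Z) (S m)) * (z + 1))
                    * p ^ S (x + m) * (1 - p) ^ S Z); [ring|].
    rewrite B1.
    transitivity (binom (x + m - 1) x * ((z - INR m) * ((z + 1) * binom (S Z) m))
                    * p ^ S (x + m) * (1 - p) ^ S Z); [ring|].
    rewrite <- B2. simpl pow. ring.
  - assert (EN : INR N - INR x = INR m).
    { replace N with (x + m)%nat by lia. rewrite plus_INR. ring. }
    rewrite EN. replace (S N - x - m)%nat with 1%nat by lia.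
    (* No trial is left for a zero and [L = m]: the factor [(1 - m) (- m)] vanishes for [m <= 1],
       and [binom 1 m] for larger [m]. *)
    destruct m as [|[|m]].
    + simpl INR; ring.
    + simpl INR; ring.
    + rewrite (binom_gt 1) by lia. ring.
Qed.

(** The ratio in [x] at fixed [m]. It is [succ_weight] up to factors free of [m], so summing over
    [m] yields the recursion for the point probabilities. *)
Lemma block_term_succ_runs p N x m :
  let L := INR N - INR x in
  block_term p N (S x) m * ((1 - p) * INR (S x) * (L - INR m + 1))
  = block_term p N x m * (p * (INR x + INR m) * (L - 2 * INR m + 1)).
Proof.
  intros L; subst L. unfold block_term.
  destruct (Nat.leb_spec (S x + m) N), (Nat.leb_spec (x + m) N); try lia; [| |ring].
  - replace (S x + m - 1)%nat with (x + m)%nat by lia.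
    replace (S N - S x - m)%nat with (N - x - m)%nat by lia.
    replace (S N - x - m)%nat with (S (N - x - m)) by lia.
    remember (N - S x - m)%nat as Z eqn:EZ.
    replace (N - x - m)%nat with (S Z) by lia.
    assert (EN : INR N - INR x = INR (S Z) + INR m).
    { replace N with (x + (S Z + m))%nat by lia. rewrite !plus_INR. ring. }
    rewrite EN.
    replace (S x + m)%nat with (S (x + m)) by lia.
    pose proof (binom_succ_l (S Z) m) as B2.
    set (z := INR (S Z)) in *.
    assert (B3 : INR (S x) * binom (x + m) (S x)
                 = (INR x + INR m) * binom (x + m - 1) x).
    { destruct (Nat.eq_dec (x + m) 0) as [E|E].
      - assert (x = O) by lia. assert (m = O) by lia. subst. simpl. ring.
      - pose proof (binom_absorb (x + m - 1) x) as B.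
        replace (S (x + m - 1)) with (x + m)%nat in B by lia.
        now rewrite (plus_INR x m) in B. }
    transitivity ((INR (S x) * binom (x + m) (S x))
       * ((z + 1) * binom (S Z) m) * p ^ S (x + m) * (1 - p) ^ S Z);
      [simpl pow; ring|].
    rewrite B3, <- B2. simpl pow. ring.
  - assert (EN : INR N - INR x = INR m).
    { replace N with (x + m)%nat by lia. rewrite plus_INR. ring. }
    rewrite EN. replace (S N - x - m)%nat with 1%nat by lia.
    destruct m as [|[|m]].
    + destruct x as [|x]; [simpl INR; ring|]. rewrite (binom_gt (S x + 0 - 1)) by lia. ring.
    + simpl INR; ring.
    + rewrite (binom_gt 1) by lia. ring.
Qed.

Lemma P_S2_blocks n p x :
  P_S2 n p x = sum_f_R0 (block_term p (S n) x) (S n).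
Proof. rewrite P_S2_run_exp. now apply run_exp_blocks. Qed.

Lemma sum_term_le g M i : (i <= M)%nat -> (forall m, 0 <= g m) -> g i <= sum_f_R0 g M.
Proof.
  intros Hi Hg. induction M as [|M IH]; simpl.
  - replace i with O by lia. lra.
  - pose proof (Hg (S M)). destruct (Nat.eq_dec i (S M)) as [->|E].
    + pose proof (cond_pos_sum g M Hg). lra.
    + specialize (IH ltac:(lia)). lra.
Qed.

Lemma P_S2_pos n p x : 0 < p < 1 -> (x <= n)%nat -> 0 < P_S2 n p x.
Proof.
  intros Hp Hx. rewrite P_S2_blocks, decomp_sum by lia. simpl pred.
  assert (H0 : 0 <= block_term p (S n) x 0) by (apply block_term_nonneg; lra).
  assert (H1 : 0 < block_term p (S n) x 1) by (apply block_term_1_pos; [lra|lia]).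
  assert (H2 : block_term p (S n) x 1 <= sum_f_R0 (fun i => block_term p (S n) x (S i)) n).
  { apply (sum_term_le (fun i => block_term p (S n) x (S i)) n 0 (Nat.le_0_l n)).
    intros m; apply block_term_nonneg; lra. }
  lra.
Qed.

(** * Stein's method for weighted sums *)

(** An expectation left unnormalised: [T] will have total mass [P_S2 n p x], so nothing has to be
    divided by it. *)
Definition wsum (T : nat -> R) (M : nat) (phi : nat -> R) : R :=
  sum_f_R0 (fun m => T m * phi m) M.

Lemma wsum_plus T M phi psi :
  wsum T M (fun m => phi m + psi m) = wsum T M phi + wsum T M psi.
Proof. unfold wsum. rewrite <- plus_sum. apply sum_eq; intros; ring. Qed.

Lemma wsum_scal T M c phi : wsum T M (fun m => c * phi m) = c * wsum T M phi.
Proof. unfold wsum. rewrite <- sum_scal_l. apply sum_eq; intros; ring. Qed.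

Lemma wsum_ext T M phi psi : (forall m, T m <> 0 -> phi m = psi m) ->
  wsum T M phi = wsum T M psi.
Proof.
  intros H. apply sum_eq; intros i _.
  destruct (Req_dec (T i) 0) as [E|E]; [rewrite E; ring|now rewrite H].
Qed.

Lemma wsum_le T M phi psi : (forall m, 0 <= T m) ->
  (forall m, T m <> 0 -> phi m <= psi m) -> wsum T M phi <= wsum T M psi.
Proof.
  intros HT H. apply sum_Rle; intros i _.
  destruct (Req_dec (T i) 0) as [E|E]; [rewrite E; lra|].
  apply Rmult_le_compat_l; auto.
Qed.

Lemma wsum_abs_le T M phi psi : (forall m, 0 <= T m) ->
  (forall m, T m <> 0 -> Rabs (phi m) <= psi m) -> Rabs (wsum T M phi) <= wsum T M psi.
Proof.
  intros HT H. apply Rabs_le. split.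
  - replace (- wsum T M psi) with ((- 1) * wsum T M psi) by ring.
    rewrite <- wsum_scal. apply wsum_le; auto. intros m Hn.
    specialize (H m Hn). apply Rabs_le_between in H. lra.
  - apply wsum_le; auto. intros m Hn.
    specialize (H m Hn). apply Rabs_le_between in H. lra.
Qed.

(** An index shift in [m] whose two boundary terms vanish; this is the summation by parts behind
    Stein's identity. *)
Lemma wsum_shift T M a b : T (S M) = 0 -> a O = 0 ->
  (forall m, T (S m) * a (S m) = T m * b m) ->
  wsum T M a = wsum T M b.
Proof.
  intros HM H0 Hrec.
  assert (E : forall k, wsum T k a + T k * b k = wsum T k b).
  { unfold wsum; induction k as [|k IH]; simpl; [rewrite H0; ring|].
    rewrite Hrec, <- IH; ring. }
  rewrite <- E, <- Hrec, HM; ring.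
Qed.

(* [H] and [F] stand for the two sides of Stein's identity; the hypothesis on
   [d * H] makes [d] concentrate, and then the one on [H] locates its mean. *)
Lemma stein_estimate T M d H F g sl G h S0 s kap kap' g0 G0 Fb :
  (forall m, 0 <= T m) -> 0 < s <= S0 -> 0 <= kap -> 0 <= kap' -> Rabs G0 <= 2 ->
  (forall m, T m <> 0 -> H m = h + d m * sl m /\ s <= sl m /\
     Rabs (sl m - S0) <= kap * Rabs (d m) /\ F m <= Fb /\
     g m = g0 + d m * G m /\ Rabs (G m - G0) <= kap' * Rabs (d m)) ->
  wsum T M H = 0 -> wsum T M (fun m => d m * H m) = wsum T M F ->
  let Z := wsum T M (fun _ => 1) in
  let V := 2 * Fb / s + h ^ 2 / s ^ 2 in
  Rabs (wsum T M g - g0 * Z) <= (kap' * V + 2 * ((kap * V + Rabs h) / s)) * Z.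
Proof.
  intros HT [Hs HS0] Hk Hk' HG0 Hm E0 E1 Z V.
  set (W := wsum T M (fun m => d m ^ 2)).
  set (D := wsum T M d).
  assert (HZ : 0 <= Z).
  { transitivity (wsum T M (fun _ => 0)); [|apply wsum_le; auto; intros; lra].
    right. unfold wsum. rewrite (sum_eq _ (fun _ => 0)) by (intros; ring).
    clear; induction M; simpl; lra. }
  assert (HW : W <= V * Z).
  (* Completing the square gives [h d >= - h^2/(2 s) - s d^2/2], so half of the quadratic term of
     [d * H] survives. *)
  { assert (A : s / 2 * W <= (Fb + h ^ 2 / (2 * s)) * Z).
    { transitivity (wsum T M (fun m => d m * H m + (h ^ 2 / (2 * s)) * 1)).
      - unfold W. rewrite <- wsum_scal. apply wsum_le; auto.
        intros m Hn. destruct (Hm m Hn) as (-> & B & _).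
        assert (0 <= (h + s * d m) ^ 2 / (2 * s)).
        { apply Rdiv_le_0_compat; [apply pow2_ge_0|lra]. }
        replace ((h + s * d m) ^ 2 / (2 * s))
          with (h ^ 2 / (2 * s) + h * d m + s / 2 * d m ^ 2) in * by (field; lra).
        assert (s * d m ^ 2 <= sl m * d m ^ 2)
          by (apply Rmult_le_compat_r; [apply pow2_ge_0|lra]).
        nra.
      - rewrite wsum_plus, wsum_scal, E1. fold Z.
        assert (wsum T M F <= Fb * Z).
        { unfold Z. rewrite <- wsum_scal. apply wsum_le; auto.
          intros m Hn. destruct (Hm m Hn) as (_ & _ & _ & B & _). lra. }
        lra. }
    apply Rmult_le_reg_l with (s / 2); [lra|].
    eapply Rle_trans; [exact A|]. right. unfold V. field. lra. }
  assert (HD : Rabs D <= (kap * V + Rabs h) / s * Z).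
  { assert (B : Rabs (S0 * D + h * Z) <= kap * W).
    (* Since [H] sums to 0, the constant slope [S0] may replace [sl] at a cost quadratic in [d].
       This locates the mean of [d] more finely than its spread does. *)
    { assert (E : S0 * D + h * Z = wsum T M (fun m => d m * (S0 - sl m))).
      { transitivity (wsum T M (fun m => S0 * d m + h * 1) + (-1) * wsum T M H).
        - rewrite E0, wsum_plus, !wsum_scal. unfold D, Z. ring.
        - rewrite <- wsum_scal, <- wsum_plus. apply wsum_ext.
          intros m Hn. destruct (Hm m Hn) as (-> & _). ring. }
      rewrite E. unfold W.
      rewrite <- wsum_scal. apply wsum_abs_le; auto. intros m Hn.
      destruct (Hm m Hn) as (_ & _ & B & _).
      rewrite Rabs_mult, (Rabs_minus_sym S0), <- (pow2_abs (d m)).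
      pose proof (Rabs_pos (d m)). nra. }
    assert (C1 : s * Rabs D <= kap * W + Rabs h * Z).
    { assert (s * Rabs D <= Rabs (S0 * D)).
      { rewrite Rabs_mult, (Rabs_pos_eq S0) by lra.
        apply Rmult_le_compat_r; [apply Rabs_pos|lra]. }
      assert (Rabs (S0 * D) <= Rabs (S0 * D + h * Z) + Rabs (h * Z)).
      { replace (S0 * D) with ((S0 * D + h * Z) - h * Z) at 1 by ring.
        eapply Rle_trans; [apply Rabs_triang|]. rewrite Rabs_Ropp. lra. }
      assert (Rabs (h * Z) = Rabs h * Z) by now rewrite Rabs_mult, (Rabs_pos_eq Z HZ).
      lra. }
    apply Rmult_le_reg_l with s; [lra|].
    replace (s * ((kap * V + Rabs h) / s * Z)) with (kap * (V * Z) + Rabs h * Z)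
      by (field; lra).
    assert (kap * W <= kap * (V * Z)) by (apply Rmult_le_compat_l; lra). lra. }
  assert (E : wsum T M g - g0 * Z = G0 * D + wsum T M (fun m => d m * (G m - G0))).
  { unfold Z, D. rewrite <- !wsum_scal, <- wsum_plus.
    apply Rplus_eq_reg_r with (wsum T M (fun _ => g0 * 1)). rewrite <- wsum_plus.
    ring_simplify.
    apply wsum_ext. intros m Hn. destruct (Hm m Hn) as (_ & _ & _ & _ & -> & _). ring. }
  rewrite E.
  assert (B : Rabs (wsum T M (fun m => d m * (G m - G0))) <= kap' * W).
  { unfold W.
    rewrite <- wsum_scal. apply wsum_abs_le; auto. intros m Hn.
    destruct (Hm m Hn) as (_ & _ & _ & _ & _ & B).
    rewrite Rabs_mult, <- (pow2_abs (d m)). pose proof (Rabs_pos (d m)). nra. }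
  eapply Rle_trans; [apply Rabs_triang|]. rewrite Rabs_mult.
  assert (Rabs G0 * Rabs D <= 2 * ((kap * V + Rabs h) / s * Z)).
  { apply Rmult_le_compat; auto using Rabs_pos. }
  assert (kap' * W <= kap' * (V * Z)) by (apply Rmult_le_compat_l; lra).
  lra.
Qed.

(** * The approximate mode of the number of blocks *)

(** The difference of the two sides' factors in the ratio of consecutive terms; its root in [m] is
    approximately the mode. *)
Definition stein_fun (p X L m : R) : R :=
  (1 - p) * block_rate X m * (L - m + 2) - p * (L - 2 * m + 1) * (L - 2 * m).

Definition succ_weight (X L m : R) : R := (X + m) * (L - 2 * m + 1) / (L - m + 1).

(** At [v = 0] the point is [n p^2] pairs and [n p (1 - p)] blocks, close to their means. The
    direction [(1 + 3p, 1 - 3p)] is tangent to the curve where the leading part of [stein_fun]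
    vanishes, so the error is quadratic in [v]. *)
Lemma stein_fun_at_mode n p v :
  0 < p <= / 100 -> 100 <= n * p -> Rabs v <= p / 100 ->
  Rabs (stein_fun p (n * (p ^ 2 + (1 + 3 * p) * v)) (n + 1 - n * (p ^ 2 + (1 + 3 * p) * v))
          (n * (p * (1 - p) + (1 - 3 * p) * v)))
  <= 3 * n ^ 2 * v ^ 2 / p + 5 * n.
Proof.
  intros Hp Hnp Hv. apply Rabs_le_between in Hv.
  assert (Hn : 0 < n) by nra.
  set (w := p * (1 - p) + (1 - 3 * p) * v).
  (* With [m = n w]: [X + m = n c], [L - m = n b + 1] and [L - 2 m = n e + 1]. *)
  set (c := p + 2 * v). set (b := (1 - p) - 2 * v). set (e := (1 - p) * ((1 - p) - 3 * v)).
  set (X := n * (p ^ 2 + (1 + 3 * p) * v)).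
  assert (Hw : 0 <= w <= 1.01 * p) by (unfold w; nra).
  assert (Hc : 0.95 * p <= c <= 1.02 * p) by (unfold c; lra).
  assert (Hb : 0 <= b <= 1.01) by (unfold b; lra).
  assert (He : 0 <= e <= 1.01) by (unfold e; nra).
  assert (HD : 9 / 10 * (n * p) <= n * c - 1) by nra.
  set (h := stein_fun _ _ _ _).
  set (q := 1 - p).
  (* The leading part is [q w^2 b - p c e^2 = v^2 R0]; [P2] and [P1] collect the lower orders in
     [n], due to the additive constants. *)
  set (R0 := q ^ 2 * (1 - 3 * p) ^ 2 - 4 * p * q ^ 2 * (1 - 3 * p) - 9 * p ^ 2 * q ^ 2
       + 12 * p * q ^ 3 - v * (2 * q * (1 - 3 * p) ^ 2 + 18 * p * q ^ 2)).
  set (P2 := 3 * q * w ^ 2 - q * w * b - p * (3 * c * e - e ^ 2)).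
  set (P1 := - (3 * q * w) - p * (2 * c - 3 * e)).
  assert (E : h * (n * c - 1) = n ^ 3 * v ^ 2 * R0 + (n ^ 2 * P2 + n * P1 + 2 * p)).
  { unfold h, stein_fun, block_rate.
    replace (X + n * w - 1) with (n * c - 1) by (unfold X, w, c; ring).
    replace (n * w - X * (n * w) / (n * c - 1)) with ((n * w) * (n * w - 1) / (n * c - 1)).
    2:{ field_simplify_eq; [|lra]. unfold X, w, c; ring. }
    field_simplify_eq; [|lra]. unfold R0, P1, P2, e, X, b, w, c, q. ring. }
  assert (HR : Rabs R0 <= 2).
  { assert (Hq : 0 <= q <= 1) by (unfold q; lra).
    assert (Hq2 : 0 <= q ^ 2 <= 1) by nra.
    assert (Hq3 : 0 <= q ^ 3 <= 1) by (replace (q ^ 3) with (q * q ^ 2) by ring; nra).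
    assert (Hs : 0 <= (1 - 3 * p) ^ 2 <= 1) by nra.
    assert (T1 : 0 <= q ^ 2 * (1 - 3 * p) ^ 2 <= 1) by nra.
    assert (T2 : 0 <= p * q ^ 2 <= / 100) by nra.
    assert (T3 : 0 <= p * q ^ 2 * (1 - 3 * p) <= / 100) by nra.
    assert (T4 : 0 <= p * (p * q ^ 2) <= / 100) by nra.
    assert (T5 : 0 <= p * q ^ 3 <= / 100) by nra.
    assert (T6 : 0 <= q * (1 - 3 * p) ^ 2 <= 1) by nra.
    assert (T7 : Rabs (v * (2 * q * (1 - 3 * p) ^ 2 + 18 * p * q ^ 2)) <= 1 / 10).
    { rewrite Rabs_mult, (Rabs_pos_eq (_ + _)) by nra.
      assert (Rabs v <= / 10000) by (apply Rabs_le; lra).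
      pose proof (Rabs_pos v). nra. }
    apply Rabs_le_between in T7. apply Rabs_le. unfold R0.
    replace (9 * p ^ 2 * q ^ 2) with (9 * (p * (p * q ^ 2))) by ring.
    replace (4 * p * q ^ 2 * (1 - 3 * p)) with (4 * (p * q ^ 2 * (1 - 3 * p))) by ring.
    replace (12 * p * q ^ 3) with (12 * (p * q ^ 3)) by ring.
    lra. }
  assert (HP2 : Rabs P2 <= 3 * p).
  { assert (Hq : 0 <= q <= 1) by (unfold q; lra).
    assert (0 <= w ^ 2 <= 0.02 * p) by nra.
    assert (0 <= q * w ^ 2 <= 0.02 * p) by nra.
    assert (0 <= q * w <= 1.01 * p) by nra.
    assert (0 <= q * w * b <= 1.03 * p) by nra.
    assert (0 <= c * e <= 0.02) by nra.
    assert (0 <= e ^ 2 <= 1.03) by nra.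
    assert (0 <= p * (c * e) <= 0.02 * p) by nra.
    assert (0 <= p * e ^ 2 <= 1.03 * p) by nra.
    apply Rabs_le. unfold P2.
    replace (p * (3 * c * e - e ^ 2)) with (3 * (p * (c * e)) - p * e ^ 2) by ring.
    lra. }
  assert (HP1 : Rabs P1 <= 7 * p).
  { assert (Hq : 0 <= q <= 1) by (unfold q; lra).
    assert (0 <= q * w <= 1.01 * p) by nra.
    assert (0 <= p * c <= p) by nra.
    assert (0 <= p * e <= 1.01 * p) by nra.
    apply Rabs_le. unfold P1. lra. }
  assert (HB : Rabs (h * (n * c - 1)) <= 2 * n ^ 3 * v ^ 2 + 4 * p * n ^ 2).
  { rewrite E. eapply Rle_trans; [apply Rabs_triang|].
    assert (0 <= n ^ 3 * v ^ 2).
    { apply Rmult_le_pos; [apply pow_le; lra|apply pow2_ge_0]. }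
    assert (Rabs (n ^ 3 * v ^ 2 * R0) <= 2 * (n ^ 3 * v ^ 2)).
    { rewrite Rabs_mult, (Rabs_pos_eq (n ^ 3 * v ^ 2)) by lra. nra. }
    assert (Rabs (n ^ 2 * P2 + n * P1 + 2 * p) <= 4 * p * n ^ 2).
    { apply Rabs_le_between in HP1. apply Rabs_le_between in HP2.
      assert (10000 <= n) by nra.
      assert (9 * n <= n ^ 2) by nra.
      assert (9 * (p * n) <= p * n ^ 2) by nra.
      assert (- (3 * (p * n ^ 2)) <= n ^ 2 * P2 <= 3 * (p * n ^ 2)) by nra.
      assert (- (7 * (p * n)) <= n * P1 <= 7 * (p * n)) by nra.
      assert (p <= p * n) by nra.
      apply Rabs_le. lra. }
    lra. }
  rewrite Rabs_mult, (Rabs_pos_eq (n * c - 1)) in HB by nra.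
  assert (HB2 : Rabs h * (9 / 10 * (n * p)) <= 2 * n ^ 3 * v ^ 2 + 4 * p * n ^ 2).
  { eapply Rle_trans; [|exact HB]. apply Rmult_le_compat_l; [apply Rabs_pos|exact HD]. }
  apply Rmult_le_reg_r with (9 / 10 * (n * p)); [nra|].
  eapply Rle_trans; [exact HB2|].
  replace ((3 * n ^ 2 * v ^ 2 / p + 5 * n) * (9 / 10 * (n * p)))
    with (27 / 10 * (n ^ 3 * v ^ 2) + 9 / 2 * (p * n ^ 2)) by (field; lra).
  assert (0 <= n ^ 3 * v ^ 2).
  { apply Rmult_le_pos; [apply pow_le; lra|apply pow2_ge_0]. }
  assert (0 <= p * n ^ 2) by nra. lra.
Qed.

(** For [X = 0] every quotient has numerator 0, so a zero denominator does no harm. *)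
Lemma block_rate_secant X m m' :
  (X = 0 \/ (X + m - 1 <> 0 /\ X + m' - 1 <> 0)) ->
  block_rate X m = block_rate X m'
    + (m - m') * (1 - X * (X - 1) / ((X + m - 1) * (X + m' - 1))).
Proof.
  unfold block_rate. intros [->|[H1 H2]].
  - unfold Rdiv. ring.
  - field. split; assumption.
Qed.

Lemma succ_weight_secant X L m m' : L - m + 1 <> 0 -> L - m' + 1 <> 0 ->
  succ_weight X L m = succ_weight X L m'
    + (m - m') * (1 - m / (L - m + 1) - (X + m') * (L + 1) / ((L - m + 1) * (L - m' + 1))).
Proof. intros H1 H2. unfold succ_weight. field. split; assumption. Qed.

(** The value is about [n p c e / (q b)]; its expansion to first order in [v] has slope
    [n p (2 - 3p) / (1 - p)]. *)
Lemma succ_weight_at_mode n p v :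
  0 < p <= / 100 -> 100 <= n * p -> Rabs v <= p / 100 ->
  Rabs (p / (1 - p) * succ_weight (n * (p ^ 2 + (1 + 3 * p) * v))
                        (n + 1 - n * (p ^ 2 + (1 + 3 * p) * v))
                        (n * (p * (1 - p) + (1 - 3 * p) * v))
        - n * (p ^ 2 + v * (p * (2 - 3 * p) / (1 - p)))) <= 20 * (p + n * v ^ 2).
Proof.
  intros Hp Hnp Hv. apply Rabs_le_between in Hv.
  assert (Hn : 10000 <= n) by nra.
  set (q := 1 - p). assert (Hq : 99 / 100 <= q <= 1) by (unfold q; lra).
  set (b := q - 2 * v). set (c := p + 2 * v). set (e := q * (q - 3 * v)).
  assert (Hc : 0 <= c <= 2 * p) by (unfold c; lra).
  assert (Hb : 9 / 10 <= b <= 2) by (unfold b; lra).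
  assert (He : 0 <= e <= 2) by (unfold e; nra).
  assert (Hnb : 0 < n * b) by nra.
  assert (E : p / q * succ_weight (n * (p ^ 2 + (1 + 3 * p) * v))
                        (n + 1 - n * (p ^ 2 + (1 + 3 * p) * v))
                        (n * (p * q + (1 - 3 * p) * v))
        - n * (p ^ 2 + v * (p * (2 - 3 * p) / q))
     = p / q * (n * c * (2 * b - 2 * e) / ((n * b + 2) * b))
       + n * v ^ 2 * (p * (- 6 * q + 2 * (2 - 3 * p)) / (q * b))).
  { unfold succ_weight.
    replace (n * (p ^ 2 + (1 + 3 * p) * v) + n * (p * q + (1 - 3 * p) * v)) with (n * c)
      by (unfold c, q; ring).
    replace (n + 1 - n * (p ^ 2 + (1 + 3 * p) * v) - 2 * (n * (p * q + (1 - 3 * p) * v)) + 1)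
      with (n * e + 2) by (unfold e, q; ring).
    replace (n + 1 - n * (p ^ 2 + (1 + 3 * p) * v) - n * (p * q + (1 - 3 * p) * v) + 1)
      with (n * b + 2) by (unfold b, q; ring).
    apply Rmult_eq_reg_r with (q * b * (n * b + 2)).
    2:{ apply Rgt_not_eq. apply Rmult_lt_0_compat; nra. }
    field_simplify; [|repeat split; lra..].
    unfold c, e, b. unfold q. field_simplify. reflexivity. }
  rewrite E. clear E.
  eapply Rle_trans; [apply Rabs_triang|].
  assert (Hpq : 0 <= p / q <= 2 * p).
  { split; [apply Rdiv_le_0_compat; lra|]. apply Rle_div_l; [lra|]. nra. }
  assert (A1 : Rabs (n * c * (2 * b - 2 * e) / ((n * b + 2) * b)) <= 6).
  { unfold Rdiv. rewrite Rabs_mult, (Rabs_pos_eq (/ _)).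
    2:{ left; apply Rinv_0_lt_compat; apply Rmult_lt_0_compat; nra. }
    apply Rle_div_l; [apply Rmult_lt_0_compat; nra|].
    assert (Rabs (n * c * (2 * b - 2 * e)) <= n * (2 * p) * 4).
    { rewrite Rabs_mult, (Rabs_pos_eq (n * c)) by nra.
      apply Rmult_le_compat; [nra|apply Rabs_pos|nra|apply Rabs_le; lra]. }
    assert (n * (8 / 10) <= (n * b + 2) * b) by nra. nra. }
  assert (A2 : Rabs (p * (- 6 * q + 2 * (2 - 3 * p)) / (q * b)) <= 12).
  { unfold Rdiv. rewrite Rabs_mult, (Rabs_pos_eq (/ _)).
    2:{ left; apply Rinv_0_lt_compat; nra. }
    apply Rle_div_l; [nra|]. assert (8 / 10 <= q * b) by nra.
    replace (p * (- 6 * q + 2 * (2 - 3 * p))) with (- (2 * p)) by (unfold q; ring).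
    rewrite Rabs_Ropp, Rabs_pos_eq by lra. lra. }
  assert (Hv2 : 0 <= n * v ^ 2) by (apply Rmult_le_pos; [lra|apply pow2_ge_0]).
  rewrite !Rabs_mult, (Rabs_pos_eq (p / q)) by lra.
  rewrite <- Rabs_mult, (Rabs_pos_eq (n * v ^ 2)) by lra.
  assert (p / q * Rabs (n * c * (2 * b - 2 * e) / ((n * b + 2) * b)) <= 2 * p * 6).
  { apply Rmult_le_compat; try lra. apply Rabs_pos. }
  assert (n * v ^ 2 * Rabs (p * (- 6 * q + 2 * (2 - 3 * p)) / (q * b)) <= n * v ^ 2 * 12).
  { apply Rmult_le_compat_l; lra. }
  lra.
Qed.

(** [stein_estimate] with a slope of order [n]. The defect [eta] of [ms] as a root is kept explicit
    because its bound grows with [v^2]. *)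
Lemma block_term_stein_estimate n p x v :
  0 < p <= / 100 -> 100 <= INR n * p -> Rabs v <= p / 100 ->
  INR x = INR n * (p ^ 2 + (1 + 3 * p) * v) ->
  let L := INR (S n) - INR x in
  let ms := INR n * (p * (1 - p) + (1 - 3 * p) * v) in
  let eta := Rabs (stein_fun p (INR x) L ms) / INR n in
  Rabs (wsum (block_term p (S n) x) (S n) (fun m => succ_weight (INR x) L (INR m))
        - succ_weight (INR x) L ms * P_S2 n p x)
  <= (720 + 720 * eta ^ 2 / (INR n * p) + 8 * eta) * P_S2 n p x.
Proof.
  intros Hp Hnp Hv HX L ms eta. pose proof (Rabs_pos v) as Hv0.
  apply Rabs_le_between in Hv.
  set (T := block_term p (S n) x).
  set (X := INR x) in *. set (nn := INR n) in *.
  assert (Hn : 10000 <= nn) by nra.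
  assert (HX0 : 0 <= X) by apply pos_INR.
  assert (HX1 : X <= nn * p / 40).
  { rewrite HX. replace (nn * p / 40) with (nn * (p / 40)) by field.
    apply Rmult_le_compat_l; nra. }
  assert (Hms : 98 / 100 * (nn * p) <= ms <= 101 / 100 * (nn * p)).
  { unfold ms. split.
    - replace (98 / 100 * (nn * p)) with (nn * (98 / 100 * p)) by ring.
      apply Rmult_le_compat_l; nra.
    - replace (101 / 100 * (nn * p)) with (nn * (101 / 100 * p)) by ring.
      apply Rmult_le_compat_l; nra. }
  assert (HLe : L = nn + 1 - X) by (unfold L, nn; rewrite S_INR; ring).
  assert (HL : 999 / 1000 * nn <= L <= nn + 1) by (rewrite HLe; nra).
  assert (Hnp2 : nn * p <= nn / 100) by nra.
  set (d := fun m : nat => INR m - ms).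
  (* [1 - theta m] is the secant slope of [block_rate] from [ms] to [m]; [theta] is small because
     [X <= n p / 40]. *)
  set (theta := fun m : R => X * (X - 1) / ((X + m - 1) * (X + ms - 1))).
  set (sl := fun m : R => (1 - p) * ((1 - theta m) * (L - m + 2) - block_rate X ms)
                     + 2 * p * (2 * L - 2 * m - 2 * ms + 1)).
  set (G := fun m : R => 1 - m / (L - m + 1)
                     - (X + ms) * (L + 1) / ((L - m + 1) * (L - ms + 1))).
  set (h := stein_fun p X L ms) in *.
  (* Integrality matters: either [X = 0] and [theta] vanishes, or [X >= 1] and [m >= 1] on the
     support, so that [X + m - 1 >= X > 0]. *)
  assert (HXi : x = O \/ 1 <= X).
  { destruct x as [|x']; [now left|right]. unfold X. rewrite S_INR.
    pose proof (pos_INR x'). lra. }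
  assert (Hsupp : forall m, T m <> 0 ->
     0 <= INR m /\ 2 * INR m <= L + 1 /\ (X = 0 \/ (1 <= X /\ 1 <= INR m))).
  { intros m Hm. destruct (block_term_support _ _ _ _ Hm) as (S1 & S2 & S3).
    split; [apply pos_INR|]. split.
    - assert (E : INR (2 * m) <= INR (S n - x + 1)) by now apply le_INR.
      rewrite mult_INR, plus_INR, minus_INR in E by lia. unfold L, X. simpl (INR 2) in E.
      simpl (INR 1) in E. lra.
    - destruct x as [|x']; [now left|right]. split.
      + unfold X. rewrite S_INR. pose proof (pos_INR x'). lra.
      + destruct m as [|m]; [now specialize (S3 eq_refl)|].
        rewrite S_INR. pose proof (pos_INR m). lra. }
  assert (Hth : forall m, (X = 0 \/ (1 <= X /\ 1 <= m)) ->
     0 <= theta m <= / 20 /\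
     Rabs (theta m - theta ms) <= Rabs (m - ms) / (nn * p)).
  { intros m [H0|[H1 H2]].
    - assert (E : forall y, theta y = 0) by (intros y; unfold theta, Rdiv; rewrite H0; ring).
      rewrite !E. split; [lra|]. replace (0 - 0) with 0 by ring. rewrite Rabs_R0.
      apply Rdiv_le_0_compat; [apply Rabs_pos|lra].
    - assert (P1 : X <= X + m - 1) by lra.
      assert (P2 : 9 / 10 * (nn * p) <= X + ms - 1) by lra.
      assert (P3 : 0 < X + m - 1) by lra. assert (P4 : 0 < X + ms - 1) by lra.
      split.
      + unfold theta. split.
        * apply Rdiv_le_0_compat; [nra|apply Rmult_lt_0_compat; lra].
        * apply Rle_div_l; [apply Rmult_lt_0_compat; lra|].
          assert (X * (X - 1) <= (X + m - 1) * (nn * p / 40)) by (apply Rmult_le_compat; lra).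
          assert ((X + m - 1) * (nn * p / 40) <= / 20 * ((X + m - 1) * (X + ms - 1))) by nra.
          lra.
      + assert (E : theta m - theta ms
          = (ms - m) * (X / (X + m - 1) * ((X - 1) / (X + ms - 1)) * / (X + ms - 1))).
        { unfold theta. field. lra. }
        rewrite E, Rabs_mult, Rabs_minus_sym. unfold Rdiv at 3.
        apply Rmult_le_compat_l; [apply Rabs_pos|].
        assert (0 <= X / (X + m - 1) <= 1).
        { split; [apply Rdiv_le_0_compat; lra|apply Rle_div_l; lra]. }
        assert (0 <= (X - 1) / (X + ms - 1) <= / 2).
        { split; [apply Rdiv_le_0_compat; lra|apply Rle_div_l; lra]. }
        assert (0 < / (X + ms - 1) <= 2 * / (nn * p)).
        { split; [now apply Rinv_0_lt_compat|].
          replace (2 * / (nn * p)) with (/ (nn * p / 2)) by (field; nra).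
          apply Rinv_le_contravar; lra. }
        assert (0 < / (nn * p)) by (apply Rinv_0_lt_compat; lra).
        rewrite Rabs_pos_eq.
        * assert (X / (X + m - 1) * ((X - 1) / (X + ms - 1)) <= 1 * / 2)
            by (apply Rmult_le_compat; lra).
          assert (0 <= X / (X + m - 1) * ((X - 1) / (X + ms - 1)))
            by (apply Rmult_le_pos; lra).
          nra.
        * apply Rmult_le_pos; [apply Rmult_le_pos|]; lra. }
  assert (HA : 0 <= block_rate X ms <= ms).
  { unfold block_rate. assert (0 < X + ms - 1) by lra.
    split.
    - replace (ms - X * ms / (X + ms - 1)) with (ms * (ms - 1) / (X + ms - 1)) by (field; lra).
      apply Rdiv_le_0_compat; [nra|lra].
    - assert (0 <= X * ms / (X + ms - 1)) by (apply Rdiv_le_0_compat; nra). lra. }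
  assert (Hms1 : X = 0 \/ (1 <= X /\ 1 <= ms)).
  { destruct HXi as [->|]; [left; reflexivity|right; lra]. }
  assert (HG0 : Rabs (G ms) <= 2).
  { unfold G. assert (0 <= ms / (L - ms + 1) <= 1).
    { split; [apply Rdiv_le_0_compat; lra|apply Rle_div_l; lra]. }
    assert (0 <= (X + ms) * (L + 1) / ((L - ms + 1) * (L - ms + 1)) <= 1).
    { split; [apply Rdiv_le_0_compat; nra|apply Rle_div_l; nra]. }
    apply Rabs_le. lra. }
  (* Per unit of [m], [theta] moves by at most [1/(n p)] and is multiplied by about [n], hence the
     [1/p]; the bounded contributions are absorbed through [1/p >= 100]. *)
  assert (Hsl : forall m, 0 <= m -> 2 * m <= L + 1 -> (X = 0 \/ (1 <= X /\ 1 <= m)) ->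
     nn / 4 <= sl m /\ Rabs (sl m - sl ms) <= 4 / p * Rabs (m - ms)).
  { intros m Hm0 Hm1 Hm2.
    destruct (Hth m Hm2) as [T1 T2]. destruct (Hth ms Hms1) as [T3 _].
    split.
    - unfold sl. assert (95 / 100 * (49 / 100 * nn) <= (1 - theta m) * (L - m + 2))
        by (apply Rmult_le_compat; lra).
      assert (0 <= 2 * p * (2 * L - 2 * m - 2 * ms + 1)) by (apply Rmult_le_pos; lra).
      nra.
    - replace (sl m - sl ms) with
        ((1 - p) * (- ((theta m - theta ms) * (L - m + 2)) - (1 - theta ms) * (m - ms))
          + (- (4 * p)) * (m - ms)) by (unfold sl; ring).
      assert (B1 : Rabs ((theta m - theta ms) * (L - m + 2)) <= 2 / p * Rabs (m - ms)).
      { rewrite Rabs_mult, (Rabs_pos_eq (L - m + 2)) by lra.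
        eapply Rle_trans.
        - apply Rmult_le_compat; [apply Rabs_pos|lra|exact T2|].
          instantiate (1 := 2 * nn). lra.
        - right. field. nra. }
      assert (B2 : Rabs ((1 - theta ms) * (m - ms)) <= Rabs (m - ms)).
      { rewrite Rabs_mult, (Rabs_pos_eq (1 - _)) by lra. pose proof (Rabs_pos (m - ms)). nra. }
      pose proof (Rabs_pos (m - ms)) as B3.
      assert (Hip : 100 <= / p).
      { rewrite <- (Rinv_inv 100). apply Rinv_le_contravar; lra. }
      eapply Rle_trans; [apply Rabs_triang|].
      rewrite !Rabs_mult, Rabs_Ropp, (Rabs_pos_eq (1 - p)), (Rabs_pos_eq (4 * p)) by lra.
      eapply Rle_trans; [apply Rplus_le_compat_r, Rmult_le_compat_l; [lra|apply Rabs_triang]|].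
      rewrite !Rabs_Ropp. unfold Rdiv in *.
      assert (Y : 0 <= 2 * / p * Rabs (m - ms)) by nra.
      set (r1 := Rabs ((theta m - theta ms) * _)) in *.
      set (r2 := Rabs ((1 - theta ms) * _)) in *.
      set (r3 := Rabs (m - ms)) in *.
      assert (0 <= r1) by apply Rabs_pos. assert (0 <= r2) by apply Rabs_pos.
      assert ((1 - p) * (r1 + r2) <= r1 + r2) by nra.
      assert (2 * r3 <= / p * r3) by nra. nra. }
  assert (HG : forall m, 0 <= m -> 2 * m <= L + 1 ->
     Rabs (G m - G ms) <= 13 / nn * Rabs (m - ms)).
  { intros m Hm0 Hm1.
    assert (P1 : (L + 1) / 2 <= L - m + 1) by lra.
    assert (P2 : (L + 1) / 2 <= L - ms + 1) by lra.
    assert (P0 : 0 < L + 1) by lra.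
    replace (G m - G ms) with
      (- ((L + 1) / (L - ms + 1) * (1 + (X + ms) / (L - ms + 1)) * / (L - m + 1)) * (m - ms))
      by (unfold G; field; lra).
    rewrite Rabs_mult, Rabs_Ropp. apply Rmult_le_compat_r; [apply Rabs_pos|].
    assert (Q1 : 0 <= (L + 1) / (L - ms + 1) <= 2).
    { split; [apply Rdiv_le_0_compat; lra|apply Rle_div_l; lra]. }
    assert (Q2 : 0 <= (X + ms) / (L - ms + 1) <= 1).
    { split; [apply Rdiv_le_0_compat; lra|apply Rle_div_l; lra]. }
    assert (Q3 : 0 < / (L - m + 1) <= 3 / nn).
    { split; [apply Rinv_0_lt_compat; lra|].
      replace (3 / nn) with (/ (nn / 3)) by (field; lra).
      apply Rinv_le_contravar; lra. }
    rewrite Rabs_pos_eq.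
    - apply Rle_trans with (2 * 2 * (3 / nn)).
      + apply Rmult_le_compat; [apply Rmult_le_pos; lra|lra| |lra].
        apply Rmult_le_compat; lra.
      + unfold Rdiv. assert (0 < / nn) by (apply Rinv_0_lt_compat; lra). lra.
    - apply Rmult_le_pos; [apply Rmult_le_pos|]; lra. }
  assert (HT : forall m, 0 <= T m) by (intros; apply block_term_nonneg; lra).
  assert (HTM : T (S (S n)) = 0) by (apply block_term_0; lia).
  assert (Hrec : forall m, T (S m) * ((1 - p) * block_rate X (INR (S m)) * (L - INR (S m) + 2))
     = T m * (p * (L - 2 * INR m + 1) * (L - 2 * INR m)))
    by (intros m; apply block_term_succ_blocks).
  assert (HA0 : block_rate X 0 = 0) by (unfold block_rate, Rdiv; ring).
  assert (EZ : wsum T (S n) (fun _ => 1) = P_S2 n p x).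
  { rewrite P_S2_blocks. apply sum_eq; intros; unfold T; ring. }
  pose proof (stein_estimate T (S n) d (fun m => stein_fun p X L (INR m))
    (fun m => p * (L - 2 * INR m + 1) * (L - 2 * INR m))
    (fun m => succ_weight X L (INR m)) (fun m => sl (INR m)) (fun m => G (INR m))
    h (sl ms) (nn / 4) (4 / p) (13 / nn) (succ_weight X L ms) (G ms) (2 * p * nn ^ 2)) as Est.
  cbv zeta in Est. rewrite EZ in Est.
  eapply Rle_trans; [apply Est|].
  - exact HT.
  - split; [lra|]. apply Hsl; lra || exact Hms1.
  - apply Rdiv_le_0_compat; lra.
  - apply Rdiv_le_0_compat; lra.
  - exact HG0.
  - intros m Hm. destruct (Hsupp m Hm) as (M0 & M1 & M2).
    destruct (Hsl _ M0 M1 M2) as [M3 M4].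
    split; [|split; [exact M3|split; [exact M4|split; [|split; [|now apply HG]]]]].
    + assert (BR : block_rate X (INR m) = block_rate X ms + d m * (1 - theta (INR m))).
      { apply block_rate_secant. destruct M2 as [M2|[M2 M2']]; [now left|right; lra]. }
      unfold h, stein_fun. rewrite BR. unfold sl, d. ring.
    + assert (0 <= (L - (L - 2 * INR m)) * (L + (L - 2 * INR m) + 1)) by (apply Rmult_le_pos; lra).
      assert (L * (L + 1) <= (nn + 1) * (nn + 2)) by (apply Rmult_le_compat; lra).
      assert ((nn + 1) * (nn + 2) <= 2 * nn ^ 2) by (clear - Hn; nra).
      assert ((L - 2 * INR m + 1) * (L - 2 * INR m) <= 2 * nn ^ 2) by lra.
      replace (2 * p * nn ^ 2) with (p * (2 * nn ^ 2)) by ring.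
      rewrite Rmult_assoc. apply Rmult_le_compat_l; lra.
    + unfold d, G. apply succ_weight_secant; lra.
  - transitivity (wsum T (S n) (fun m => (1 - p) * block_rate X (INR m) * (L - INR m + 2))
        + (-1) * wsum T (S n) (fun m => p * (L - 2 * INR m + 1) * (L - 2 * INR m))).
    + rewrite <- wsum_scal, <- wsum_plus. apply wsum_ext. intros; unfold stein_fun; ring.
    + rewrite (wsum_shift T (S n) _ (fun m => p * (L - 2 * INR m + 1) * (L - 2 * INR m)) HTM).
      * ring.
      * simpl INR. rewrite HA0. ring.
      * exact Hrec.
  - transitivity (wsum T (S n) (fun m => d m * ((1 - p) * block_rate X (INR m) * (L - INR m + 2)))
        + (-1) * wsum T (S n) (fun m => d m * (p * (L - 2 * INR m + 1) * (L - 2 * INR m)))).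
    + rewrite <- wsum_scal, <- wsum_plus. apply wsum_ext. intros; unfold stein_fun; ring.
    (* The shift turns [d m] into [d (S m) = d m + 1], and the added 1 leaves the right-hand
       function of the identity. *)
    + rewrite (wsum_shift T (S n) _
        (fun m => d (S m) * (p * (L - 2 * INR m + 1) * (L - 2 * INR m))) HTM).
      * rewrite <- wsum_scal, <- wsum_plus. apply wsum_ext. intros; unfold d; rewrite S_INR; ring.
      * simpl INR. rewrite HA0. ring.
      * intros m. transitivity (d (S m) * (T (S m) * ((1 - p) * block_rate X (INR (S m)) * (L - INR (S m) + 2))));
          [ring|]. rewrite Hrec. ring.
  - apply Rmult_le_compat_r.
    { rewrite P_S2_blocks. now apply cond_pos_sum. }
    assert (Eh : Rabs h = nn * eta) by (unfold eta; field; lra).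
    assert (Eh2 : h ^ 2 = nn ^ 2 * eta ^ 2) by (rewrite <- (pow2_abs h), Eh; ring).
    rewrite Eh, Eh2.
    assert (He2 : 0 <= eta ^ 2 / (nn * p)) by (apply Rdiv_le_0_compat; [apply pow2_ge_0|lra]).
    (* Here [V = 16 n p + 16 eta^2]; its products with [13/n] and [8/n * (4/p)] give 208 and 512,
       and [720 = 208 + 512]. *)
    apply Rle_trans with ((208 * p + 512) + (208 * p + 512) * (eta ^ 2 / (nn * p)) + 8 * eta).
    + right. field. lra.
    + assert ((208 * p + 512) * (eta ^ 2 / (nn * p)) <= 720 * (eta ^ 2 / (nn * p)))
        by (apply Rmult_le_compat_r; lra).
      unfold Rdiv in *. lra.
Qed.

(** * The recursion for the point probabilities *)

(** With [d0 = p (2 - 3p)] one has [(1 - p) (1 + 3p) = 1 + d0], so the slope is [d0 / (1 + d0)]: up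
    to a relative [O(1/n)], the excess of the variance over the mean divided by the variance. [K]
    allows windows wider than [lam], as needed for bounded [lam]. *)
Lemma P_S2_succ_ratio K : 1 <= K -> exists C, 0 < C /\ forall n p x,
  0 < p -> K * p <= / 100 -> 100 <= INR n * p -> INR x <= K * (INR n * p ^ 2) ->
  Rabs (P_S2 n p (S x) * INR (S x)
        - P_S2 n p x * (INR n * p ^ 2 + (INR x - INR n * p ^ 2)
                          * (p * (2 - 3 * p) / ((1 - p) * (1 + 3 * p)))))
  <= C * (p + (INR x - INR n * p ^ 2) ^ 2 / INR n) * P_S2 n p x.
Proof.
  intros HK.
  set (A := 3 * (1 + K ^ 2) + 2).
  set (B := 5 * (720 * A + 8) + 720).
  exists (2 * B + 20). split; [unfold B, A; nra|].
  intros n p x Hp HKp Hnp Hx.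
  assert (Hp1 : p <= / 100) by nra.
  set (nn := INR n) in *.
  assert (Hn : 10000 <= nn) by nra.
  set (v := (INR x / nn - p ^ 2) / (1 + 3 * p)).
  assert (HX : INR x = nn * (p ^ 2 + (1 + 3 * p) * v)) by (unfold v; field; lra).
  pose proof (pos_INR x) as HX0.
  assert (Hxn : 0 <= INR x / nn <= K * p ^ 2).
  { split; [apply Rdiv_le_0_compat; lra|apply Rle_div_l; lra]. }
  assert (HvK : Rabs v <= K * p ^ 2).
  { unfold v, Rdiv. rewrite Rabs_mult, (Rabs_pos_eq (/ (1 + 3 * p)))
      by (left; apply Rinv_0_lt_compat; lra).
    apply Rle_div_l; [lra|].
    assert (Rabs (INR x * / nn - p ^ 2) <= K * p ^ 2).
    { apply Rabs_le. unfold Rdiv in Hxn. nra. }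
    assert (0 <= K * p ^ 2) by nra. nra. }
  assert (Hv : Rabs v <= p / 100) by nra.
  pose proof (block_term_stein_estimate n p x v (conj Hp Hp1) Hnp Hv HX) as E1.
  pose proof (succ_weight_at_mode nn p v (conj Hp Hp1) Hnp Hv) as E2.
  pose proof (stein_fun_at_mode nn p v (conj Hp Hp1) Hnp Hv) as E3.
  cbv zeta in E1. rewrite S_INR in E1. fold nn in E1. rewrite <- HX in E2, E3.
  set (L := nn + 1 - INR x) in *.
  set (ms := nn * (p * (1 - p) + (1 - 3 * p) * v)) in *.
  set (eta := Rabs (stein_fun p (INR x) L ms) / nn) in *.
  set (f := P_S2 n p x) in *.
  assert (Hf : 0 <= f).
  { unfold f. rewrite P_S2_blocks. apply cond_pos_sum. intros; apply block_term_nonneg; lra. }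
  set (W := wsum _ _ _) in E1.
  assert (EW : P_S2 n p (S x) * INR (S x) = p / (1 - p) * W).
  { unfold W. rewrite <- wsum_scal, P_S2_blocks, Rmult_comm, <- sum_scal_l.
    apply sum_eq. intros m _.
    (* Where the term for [x] vanishes there is no ratio; the cross-multiplied relation then forces
       the term for [S x] to vanish, its factor being positive on the support. *)
    destruct (Req_dec (block_term p (S n) x m) 0) as [Z|Z].
    - pose proof (block_term_succ_runs p (S n) x m) as R. cbv zeta in R.
      rewrite Z, Rmult_0_l in R. rewrite Z, Rmult_0_l.
      rewrite (S_INR n) in R.
      destruct (Req_dec (block_term p (S n) (S x) m) 0) as [Z'|Z']; [rewrite Z'; ring|].
      destruct (block_term_support _ _ _ _ Z') as (S1 & S2 & _).
      apply le_INR in S1. rewrite plus_INR, !S_INR in S1. fold nn in R, S1.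
      apply Rmult_integral in R. destruct R as [R|R]; [contradiction|].
      assert (0 < (1 - p) * INR (S x) * (nn + 1 - INR x - INR m + 1)).
      { rewrite S_INR. apply Rmult_lt_0_compat; [apply Rmult_lt_0_compat; lra|lra]. }
      lra.
    - pose proof (block_term_succ_runs p (S n) x m) as R. cbv zeta in R.
      destruct (block_term_support _ _ _ _ Z) as (S1 & S2 & _).
      apply le_INR in S1. rewrite plus_INR, S_INR in S1.
      rewrite (S_INR n) in R. fold nn in R, S1. fold L in R.
      assert (HL : 0 < L - INR m + 1) by (unfold L; lra).
      unfold succ_weight.
      apply Rmult_eq_reg_r with ((1 - p) * (L - INR m + 1)).
      2:{ apply Rgt_not_eq, Rmult_lt_0_compat; lra. }
      transitivity (block_term p (S n) x m * (p * (INR x + INR m) * (L - 2 * INR m + 1))).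
      + rewrite <- R. ring.
      + field. lra. }
  set (D := INR x - nn * p ^ 2).
  assert (HD : D = nn * (1 + 3 * p) * v) by (unfold D; rewrite HX; ring).
  assert (HvD : nn * v ^ 2 <= D ^ 2 / nn).
  { rewrite HD. replace ((nn * (1 + 3 * p) * v) ^ 2 / nn) with ((1 + 3 * p) ^ 2 * (nn * v ^ 2))
      by (field; lra).
    assert (0 <= nn * v ^ 2) by (apply Rmult_le_pos; [lra|apply pow2_ge_0]). nra. }
  replace (nn * (p ^ 2 + v * (p * (2 - 3 * p) / (1 - p))))
    with (nn * p ^ 2 + D * (p * (2 - 3 * p) / ((1 - p) * (1 + 3 * p)))) in E2
    by (rewrite HD; field; lra).
  set (c := nn * p ^ 2 + D * _) in *.
  set (g0 := succ_weight (INR x) L ms) in *.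
  assert (Hv2 : 0 <= nn * v ^ 2) by (apply Rmult_le_pos; [lra|apply pow2_ge_0]).
  assert (He0 : 0 <= eta) by (apply Rdiv_le_0_compat; [apply Rabs_pos|lra]).
  assert (He : p * eta <= 5 * (p + nn * v ^ 2)).
  { assert (p * eta <= p * (3 * nn * v ^ 2 / p + 5)).
    { apply Rmult_le_compat_l; [lra|]. unfold eta. apply Rle_div_l; [lra|].
      eapply Rle_trans; [exact E3|]. right. field. lra. }
    replace (p * (3 * nn * v ^ 2 / p + 5)) with (3 * (nn * v ^ 2) + 5 * p) in * by (field; lra).
    lra. }
  assert (HeA : eta / (nn * p) <= A).
  { apply Rle_div_l; [lra|]. unfold eta. apply Rle_div_l; [lra|].
    eapply Rle_trans; [exact E3|].
    assert (v ^ 2 <= (K * p ^ 2) ^ 2).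
    { rewrite <- (pow2_abs v). apply pow_incr. split; [apply Rabs_pos|exact HvK]. }
    assert (3 * nn ^ 2 * v ^ 2 / p <= 3 * K ^ 2 * (nn ^ 2 * p)).
    { apply Rle_div_l; [lra|].
      assert (nn ^ 2 * v ^ 2 <= nn ^ 2 * (K * p ^ 2) ^ 2)
        by (apply Rmult_le_compat_l; [apply pow2_ge_0|assumption]).
      assert (K ^ 2 * nn ^ 2 * p ^ 4 <= K ^ 2 * nn ^ 2 * p ^ 2).
      { apply Rmult_le_compat_l; [apply Rmult_le_pos; apply pow2_ge_0|].
        replace (p ^ 4) with (p ^ 2 * p ^ 2) by ring. assert (0 <= p ^ 2 <= 1) by (clear - Hp Hp1; nra).
        rewrite <- (Rmult_1_r (p ^ 2)) at 3. apply Rmult_le_compat_l; lra. }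
      replace (nn ^ 2 * (K * p ^ 2) ^ 2) with (K ^ 2 * nn ^ 2 * p ^ 4) in * by ring.
      replace (3 * K ^ 2 * (nn ^ 2 * p) * p) with (3 * (K ^ 2 * nn ^ 2 * p ^ 2)) by ring.
      lra. }
    assert (nn <= nn ^ 2 * p) by nra.
    unfold A. nra. }
  (* In [p * eta^2 / (n p)], [A] bounds [eta / (n p)] and [5 (p + n v^2)] bounds [p * eta]. *)
  assert (HB : p * (720 + 720 * eta ^ 2 / (nn * p) + 8 * eta) <= B * (p + nn * v ^ 2)).
  { assert (p * (eta * (eta / (nn * p))) <= p * (eta * A)).
    { apply Rmult_le_compat_l; [lra|]. apply Rmult_le_compat_l; lra. }
    replace (p * (720 + 720 * eta ^ 2 / (nn * p) + 8 * eta))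
      with (720 * p + 720 * (p * (eta * (eta / (nn * p)))) + 8 * (p * eta)) by (field; lra).
    assert (HA : 0 <= A) by (unfold A; nra).
    assert ((720 * A + 8) * (p * eta) <= (720 * A + 8) * (5 * (p + nn * v ^ 2))).
    { apply Rmult_le_compat_l; lra. }
    unfold B. nra. }
  assert (Hpq : 0 <= p / (1 - p) <= 2 * p).
  { split; [apply Rdiv_le_0_compat; lra|]. apply Rle_div_l; [lra|]. nra. }
  rewrite EW.
  replace (p / (1 - p) * W - f * c)
    with (p / (1 - p) * (W - g0 * f) + (p / (1 - p) * g0 - c) * f) by ring.
  eapply Rle_trans; [apply Rabs_triang|].
  rewrite !Rabs_mult, (Rabs_pos_eq f), (Rabs_pos_eq (p / (1 - p))) by lra.
  set (bd := 720 + 720 * eta ^ 2 / (nn * p) + 8 * eta) in *.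
  assert (F1 : p / (1 - p) * Rabs (W - g0 * f) <= 2 * (B * (p + nn * v ^ 2)) * f).
  { apply Rle_trans with ((2 * p) * (bd * f)).
    - apply Rmult_le_compat; [lra|apply Rabs_pos|lra|exact E1].
    - replace (2 * p * (bd * f)) with (2 * (p * bd) * f) by ring.
      apply Rmult_le_compat_r; lra. }
  assert (F2 : Rabs (p / (1 - p) * g0 - c) * f <= 20 * (p + nn * v ^ 2) * f).
  { apply Rmult_le_compat_r; lra. }
  assert (F3 : (2 * B + 20) * (p + nn * v ^ 2) * f <= (2 * B + 20) * (p + D ^ 2 / nn) * f).
  { apply Rmult_le_compat_r; [lra|]. apply Rmult_le_compat_l; [unfold B, A; nra|lra]. }
  lra.
Qed.

(** * Mass and moments of the negative binomial law *)

Lemma NB_succ r pb j : NB r pb (S j) * INR (S j) = NB r pb j * (pb * (r + INR j)).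
Proof.
  unfold NB. rewrite fact_simpl, mult_INR. cbn [rising pow].
  pose proof (INR_fact_neq_0 j). pose proof (not_0_INR (S j) ltac:(lia)).
  field. split; assumption.
Qed.

Lemma NB_pos r pb j : 0 < r -> 0 < pb -> 0 < NB r pb j.
Proof.
  intros Hr Hp. unfold NB.
  assert (0 < rising r j).
  { induction j as [|j IH]; simpl; [lra|].
    pose proof (pos_INR j). apply Rmult_lt_0_compat; lra. }
  repeat apply Rmult_lt_0_compat; try assumption.
  - apply Rinv_0_lt_compat, INR_fact_lt_0.
  - apply exp_pos.
  - now apply pow_lt.
Qed.

Lemma is_lim_seq_succ_ratio a :
  is_lim_seq (fun n => (a + INR n) / INR (S n)) 1.
Proof.
  apply is_lim_seq_ext with (fun n => 1 + (a - 1) * / INR (S n)).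
  { intros n. rewrite S_INR. pose proof (pos_INR n). field. lra. }
  replace (Finite 1) with (Finite (1 + (a - 1) * 0)) by (f_equal; ring).
  apply is_lim_seq_plus'; [apply is_lim_seq_const|].
  apply (is_lim_seq_scal_l _ (a - 1) (Finite 0)).
  apply (is_lim_seq_inv _ p_infty); [|discriminate].
  apply (is_lim_seq_incr_1 INR), is_lim_seq_INR.
Qed.

(** The coefficient recursion says [(1 - u) F' = r F], so [F u * (1 - u)^r] has derivative 0 and
    keeps its value 1 at [u = 0]. *)
Lemma rising_series r t : 0 < r -> 0 < t < 1 ->
  PSeries (fun j => rising r j / INR (fact j)) t * Rpower (1 - t) r = 1.
Proof.
  intros Hr Ht. set (a := fun j => rising r j / INR (fact j)).
  assert (Ha : forall n, 0 < a n).
  (* At [pb = 1] the factor [Rpower 0 r] is still positive, being an exponential by definition, and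
     can be cancelled. *)
  { intros n. pose proof (NB_pos r 1 n Hr Rlt_0_1) as H. unfold NB in H.
    rewrite pow1, Rmult_1_r in H. unfold a.
    apply Rmult_lt_reg_r with (Rpower (1 - 1) r); [apply exp_pos|]. lra. }
  assert (Hrec : forall n, INR (S n) * a (S n) = (r + INR n) * a n).
  { intros n. unfold a. rewrite fact_simpl, mult_INR. cbn [rising].
    pose proof (INR_fact_neq_0 n). pose proof (not_0_INR (S n) ltac:(lia)).
    field. split; assumption. }
  assert (HCV : CV_radius a = 1).
  { replace 1 with (/ 1) by field.
    apply CV_radius_finite_DAlembert; [intros n; apply Rgt_not_eq, Ha|lra|].
    apply is_lim_seq_ext with (fun n => (r + INR n) / INR (S n)); [|apply is_lim_seq_succ_ratio].
    intros n. pose proof (Ha n). pose proof (Ha (S n)). pose proof (lt_0_INR (S n) ltac:(lia)).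
    rewrite Rabs_pos_eq by (apply Rdiv_le_0_compat; lra).
    apply Rmult_eq_reg_r with (INR (S n) * a n); [|apply Rgt_not_eq, Rmult_lt_0_compat; lra].
    field_simplify; [|lra|lra]. rewrite Hrec. ring. }
  assert (Hin : forall u, 0 <= u <= t -> Rbar_lt (Rabs u) (CV_radius a)).
  { intros u Hu. rewrite HCV, Rabs_pos_eq by lra. simpl. lra. }
  assert (Hode : forall u, 0 <= u <= t ->
    PSeries (PS_derive a) u = r * PSeries a u + u * PSeries (PS_derive a) u).
  { intros u Hu.
    assert (X1 : ex_pseries a u) by now apply CV_radius_inside, Hin.
    assert (X2 : ex_pseries (PS_derive a) u).
    { apply CV_radius_inside. rewrite CV_radius_derive. now apply Hin. }
    rewrite <- PSeries_scal, <- PSeries_incr_1, <- PSeries_plus.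
    - apply PSeries_ext. intros [|n].
      + change (INR 1 * a 1%nat = r * a O + 0). rewrite Hrec. simpl. ring.
      + change (INR (S (S n)) * a (S (S n)) = r * a (S n) + INR (S n) * a (S n)).
        rewrite Hrec. ring.
    - apply ex_pseries_scal; [apply Rmult_comm|exact X1].
    - now apply ex_pseries_incr_1. }
  assert (E : PSeries a 0 * Rpower (1 - 0) r = PSeries a t * Rpower (1 - t) r).
  { apply (eq_is_derive (fun u => PSeries a u * Rpower (1 - u) r)); [|lra].
    intros u Hu.
    assert (D1 := is_derive_PSeries a u (Hin u Hu)).
    assert (D2 : is_derive (fun u => Rpower (1 - u) r) u (- (r * (Rpower (1 - u) r / (1 - u))))).
    { unfold Rpower. auto_derive; [lra|]. unfold Rminus. field. lra. }
    evar_last; [apply (is_derive_mult _ _ _ _ _ D1 D2); exact Rmult_comm|].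
    unfold plus, mult, zero; simpl. pose proof (Hode u Hu) as HO.
    set (F' := PSeries (PS_derive a) u) in *. set (F := PSeries a u) in *.
    replace F' with (r * F / (1 - u)); [field; lra|].
    apply Rmult_eq_reg_r with (1 - u); [|lra]. field_simplify; [|lra]. lra. }
  rewrite <- E, PSeries_0. unfold a. simpl. rewrite Rminus_0_r.
  unfold Rpower. rewrite ln_1, Rmult_0_r, exp_0. field.
Qed.

(** The weight [(j + 1)^2] never vanishes, as the ratio test requires, and dominates 1, [j] and
    [j^2] together. *)
Lemma NB_ex_series_sqr r pb : 0 < r -> 0 < pb < 1 ->
  ex_series (fun j => INR (S j) ^ 2 * NB r pb j).
Proof.
  intros Hr Hp.
  assert (Hpos : forall j, 0 < INR (S j) ^ 2 * NB r pb j).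
  { intros j. apply Rmult_lt_0_compat; [apply pow_lt, lt_0_INR; lia|now apply NB_pos]. }
  apply ex_series_ext with (fun j => Rabs (INR (S j) ^ 2 * NB r pb j)).
  { intros j. apply Rabs_pos_eq. left; apply Hpos. }
  apply ex_series_DAlembert with pb; [lra|intros j; apply Rgt_not_eq, Hpos|].
  apply is_lim_seq_ext with
    (fun j => ((2 + INR j) / INR (S j)) * ((2 + INR j) / INR (S j))
              * ((r + INR j) / INR (S j)) * pb).
  { intros j. rewrite Rabs_pos_eq by (apply Rdiv_le_0_compat; [left; apply Hpos|apply Hpos]).
    pose proof (NB_succ r pb j) as E. pose proof (NB_pos r pb j Hr (proj1 Hp)).
    pose proof (pos_INR j).
    assert (E2 : NB r pb (S j) = NB r pb j * (pb * (r + INR j)) / INR (S j)).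
    { rewrite <- E. field. rewrite S_INR; lra. }
    rewrite E2, !S_INR. field. lra. }
  replace (Finite pb) with (Finite (1 * 1 * 1 * pb)) by (f_equal; ring).
  apply is_lim_seq_mult'; [|apply is_lim_seq_const].
  apply is_lim_seq_mult'; [|apply is_lim_seq_succ_ratio].
  apply is_lim_seq_mult'; apply is_lim_seq_succ_ratio.
Qed.

Lemma NB_series r pb : 0 < r -> 0 < pb < 1 -> is_series (NB r pb) 1.
Proof.
  intros Hr Hp.
  rewrite <- (rising_series r pb Hr Hp). unfold PSeries.
  assert (X : ex_series (NB r pb)).
  { refine (ex_series_le (NB r pb) (fun j => INR (S j) ^ 2 * NB r pb j) _ (NB_ex_series_sqr r pb Hr Hp)).
    intros j. pose proof (NB_pos r pb j Hr (proj1 Hp)). pose proof (pos_INR j).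
    change (Rabs (NB r pb j) <= INR (S j) ^ 2 * NB r pb j).
    rewrite Rabs_pos_eq by lra. rewrite S_INR. nra. }
  apply Series_correct in X. rewrite Rmult_comm, <- Series_scal_l.
  rewrite <- (Series_ext (NB r pb)); [exact X|].
  intros j. unfold NB. ring.
Qed.

(** The term at [j = 0] drops out, and [NB_succ] turns the rest into a linear equation for each
    moment in terms of itself and lower ones. *)
Lemma NB_variance r pb : 0 < r -> 0 < pb < 1 ->
  is_series (fun j => (INR j - r * pb / (1 - pb)) ^ 2 * NB r pb j) (r * pb / (1 - pb) ^ 2).
Proof.
  intros Hr Hp.
  pose proof (NB_series r pb Hr Hp) as S0.
  pose proof (NB_ex_series_sqr r pb Hr Hp) as X.
  assert (X1 : ex_series (fun j => INR j * NB r pb j)).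
  { refine (ex_series_le (fun j => INR j * NB r pb j) (fun j => INR (S j) ^ 2 * NB r pb j) _ X).
    intros j. pose proof (NB_pos r pb j Hr (proj1 Hp)). pose proof (pos_INR j).
    change (Rabs (INR j * NB r pb j) <= INR (S j) ^ 2 * NB r pb j).
    rewrite Rabs_pos_eq by nra. rewrite S_INR. nra. }
  assert (X2 : ex_series (fun j => INR j ^ 2 * NB r pb j)).
  { refine (ex_series_le (fun j => INR j ^ 2 * NB r pb j) (fun j => INR (S j) ^ 2 * NB r pb j) _ X).
    intros j. pose proof (NB_pos r pb j Hr (proj1 Hp)). pose proof (pos_INR j).
    change (Rabs (INR j ^ 2 * NB r pb j) <= INR (S j) ^ 2 * NB r pb j).
    rewrite Rabs_pos_eq by nra. rewrite S_INR. nra. }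
  assert (E0 := is_series_unique _ _ S0).
  assert (X0 : ex_series (NB r pb)) by (eexists; exact S0).
  assert (E1 : Series (fun j => INR j * NB r pb j) = r * pb / (1 - pb)).
  { assert (E : Series (fun j => INR j * NB r pb j)
              = pb * (r * 1 + Series (fun j => INR j * NB r pb j))).
    { rewrite (Series_incr_1 _ X1) at 1. rewrite <- E0, <- Series_scal_l, <- Series_plus, <- Series_scal_l.
      - simpl (INR 0). rewrite Rmult_0_l, Rplus_0_l. apply Series_ext. intros j.
        rewrite Rmult_comm, NB_succ. ring.
      - apply (ex_series_scal_l r (NB r pb)), X0.
      - exact X1. }
    apply Rmult_eq_reg_r with (1 - pb); [|lra]. field_simplify; [|lra]. lra. }
  assert (E2 : Series (fun j => INR j ^ 2 * NB r pb j)
               = r * pb / (1 - pb) ^ 2 + (r * pb / (1 - pb)) ^ 2).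
  { assert (E : Series (fun j => INR j ^ 2 * NB r pb j)
              = pb * (r * 1 + ((r + 1) * Series (fun j => INR j * NB r pb j)
                               + Series (fun j => INR j ^ 2 * NB r pb j)))).
    { rewrite (Series_incr_1 _ X2) at 1.
      replace (r * 1) with (r * Series (NB r pb)) by now rewrite E0.
      rewrite <- !Series_scal_l, <- !Series_plus, <- Series_scal_l.
      - simpl (INR 0). rewrite pow_ne_zero, Rmult_0_l, Rplus_0_l by lia.
        apply Series_ext. intros j.
        transitivity (INR (S j) * (NB r pb (S j) * INR (S j))); [ring|].
        rewrite NB_succ, S_INR. ring.
      - apply (ex_series_scal_l r (NB r pb)), X0.
      - apply (ex_series_plus (fun j => (r + 1) * (INR j * NB r pb j)));
          [apply (ex_series_scal_l (r + 1) (fun j => INR j * NB r pb j)), X1|exact X2].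
      - apply (ex_series_scal_l (r + 1) (fun j => INR j * NB r pb j)), X1.
      - exact X2. }
    rewrite E1 in E. apply Rmult_eq_reg_r with (1 - pb); [|lra].
    transitivity (pb * (r * 1 + (r + 1) * (r * pb / (1 - pb)))); [lra|]. field. lra. }
  set (mu := r * pb / (1 - pb)) in *.
  pose proof (Series_correct _ X1) as C1. pose proof (Series_correct _ X2) as C2.
  rewrite E1 in C1. rewrite E2 in C2.
  pose proof (is_series_plus _ _ _ _ C2 (is_series_plus _ _ _ _
     (is_series_scal_l (- 2 * mu) _ _ C1) (is_series_scal_l (mu ^ 2) _ _ S0))) as Sm.
  unfold plus, scal in Sm; simpl in Sm; unfold mult in Sm; simpl in Sm.
  replace (r * pb / (1 - pb) ^ 2) with
    (r * pb / ((1 - pb) * ((1 - pb) * 1)) + mu * (mu * 1) + (- 2 * mu * mu + mu * (mu * 1) * 1))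
    by (simpl; ring).
  refine (is_series_ext _ _ _ _ Sm).
  intros j. simpl. ring.
Qed.

(** * Chebyshev's inequality for both laws *)

(** Pointwise, [b j - (j - lam)^2 b j / w^2] is at most the truncation of [b j] to the window. [J]
    is any bound beyond the window, which makes the window mass a finite sum. *)
Lemma chebyshev_window b lam V w J :
  (forall j, 0 <= b j) -> is_series b 1 ->
  is_series (fun j => (INR j - lam) ^ 2 * b j) V -> 0 < w ->
  (forall j, Rabs (INR j - lam) <= w -> (j <= J)%nat) ->
  1 - V / w ^ 2
    <= sum_f_R0 (fun j => if Rle_dec (Rabs (INR j - lam)) w then b j else 0) J <= 1.
Proof.
  intros Hb S1 SV Hw HJ.
  set (c := fun j => if Rle_dec (Rabs (INR j - lam)) w then b j else 0).
  assert (Hc : forall N, (J <= N)%nat -> sum_f_R0 c N = sum_f_R0 c J).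
  { intros N HN. induction HN as [|N HN IH]; [reflexivity|].
    simpl. rewrite IH. unfold c at 2.
    destruct (Rle_dec _ w) as [Hle|_]; [apply HJ in Hle; lia|ring]. }
  assert (Hw2 : 0 < w ^ 2) by now apply pow_lt.
  split.
  - pose proof (is_series_plus _ _ _ _ S1 (is_series_scal_l (- / w ^ 2) _ _ SV)) as Sd.
    unfold is_series in Sd.
    assert (LE : Rbar_le (1 - V / w ^ 2) (sum_f_R0 c J)).
    { refine (is_lim_seq_le_loc _ (fun _ => sum_f_R0 c J) _ _ _ _ (is_lim_seq_const _)).
      2:{ replace (Finite (1 - V / w ^ 2)) with
            (Finite (plus 1 (scal (- / w ^ 2) V))); [exact Sd|].
          f_equal. unfold plus, scal; simpl; unfold mult; simpl. field. lra. }
      exists J. intros N HN. rewrite <- (Hc N HN), sum_n_Reals.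
      apply sum_Rle. intros j _.
      change (b j + - / w ^ 2 * ((INR j - lam) ^ 2 * b j) <= c j). unfold c.
      specialize (Hb j).
      assert (A : 0 <= (INR j - lam) ^ 2 * b j) by (apply Rmult_le_pos; [apply pow2_ge_0|lra]).
      assert (I : 0 < / w ^ 2) by now apply Rinv_0_lt_compat.
      destruct (Rle_dec _ w) as [Hle|Hgt].
      - assert (0 <= / w ^ 2 * ((INR j - lam) ^ 2 * b j)) by (apply Rmult_le_pos; lra). lra.
      - assert (H : w ^ 2 <= (INR j - lam) ^ 2).
        { rewrite <- (pow2_abs (INR j - lam)). apply pow_incr. lra. }
        assert (/ w ^ 2 * (w ^ 2 * b j) <= / w ^ 2 * ((INR j - lam) ^ 2 * b j)).
        { apply Rmult_le_compat_l; [lra|]. now apply Rmult_le_compat_r. }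
        rewrite <- Rmult_assoc, Rinv_l, Rmult_1_l in H0 by lra. lra. }
    exact LE.
  - apply Rle_trans with (sum_f_R0 b J).
    + apply sum_Rle. intros j _. unfold c. specialize (Hb j). destruct (Rle_dec _ w); lra.
    + rewrite <- sum_n_Reals. apply is_lim_seq_incr_compare; [exact S1|].
      intros N. rewrite sum_Sn. unfold plus; simpl. specialize (Hb (S N)). lra.
Qed.

Lemma is_series_eventually_sum a N0 l :
  (forall N, (N0 <= N)%nat -> sum_f_R0 a N = l) -> is_series a l.
Proof.
  intros H. apply (is_lim_seq_ext_loc (fun _ => l) (sum_n a) l); [|apply is_lim_seq_const].
  exists N0. intros N HN. now rewrite sum_n_Reals, H.
Qed.

Lemma P_S2_series n p : is_series (P_S2 n p) 1.
Proof.
  apply is_series_eventually_sum with (S n). intros N HN.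
  rewrite (sum_eq _ (fun j => 1 * run_exp p false (S n) (indic j)))
    by (intros; rewrite P_S2_run_exp; ring).
  rewrite (run_exp_sum p false (S n) (fun _ => 1)) by exact HN. apply run_exp_const.
Qed.

Lemma P_S2_variance n p : (1 <= n)%nat ->
  is_series (fun j => (INR j - INR n * p ^ 2) ^ 2 * P_S2 n p j)
    (INR n * p ^ 2 + NB_denom_part n p).
Proof.
  intros Hn. apply is_series_eventually_sum with (S n). intros N HN.
  rewrite <- (runs_variance p n Hn), <- (run_exp_sum p false (S n) _ N HN).
  apply sum_eq. intros j _. now rewrite P_S2_run_exp.
Qed.

(** Overdispersion starts with two summands: for [n = 1] the excess of the variance over the mean is
    [- p^4]. *)
Lemma NB_denom_part_bounds n p : 0 < p <= / 100 -> 2 <= INR n ->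
  0 < NB_denom_part n p <= 2 * p * (INR n * p ^ 2).
Proof.
  intros Hp Hn.
  replace (NB_denom_part n p) with (p ^ 3 * (INR n * (2 - 3 * p) - 2 * (1 - p)))
    by (unfold NB_denom_part; ring).
  assert (0 < p ^ 3) by (apply pow_lt; lra). split.
  - apply Rmult_lt_0_compat; nra.
  - replace (2 * p * (INR n * p ^ 2)) with (p ^ 3 * (2 * INR n)) by ring.
    apply Rmult_le_compat_l; nra.
Qed.

(** * Slow variation of the ratio of the two laws *)

Definition mass_ratio (n : nat) (p : R) (j : nat) : R :=
  P_S2 n p j / NB (r_par n p) (pbar_par n p) j.

(** The parameters are [r = lam^2 / D] and [pbar = D / (lam + D)], the solution of the moment
    equations for mean [lam] and variance [lam + D]. The last clause centres the recursion factor at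
    the mean. *)
Lemma NB_par_facts n p : 0 < p <= / 100 -> 2 <= INR n ->
  let lam := INR n * p ^ 2 in let D := NB_denom_part n p in
  0 < r_par n p /\ 0 < pbar_par n p < 1 /\
  r_par n p * pbar_par n p / (1 - pbar_par n p) = lam /\
  r_par n p * pbar_par n p / (1 - pbar_par n p) ^ 2 = lam + D /\
  forall j, pbar_par n p * (r_par n p + j) = lam + (j - lam) * (D / (lam + D)).
Proof.
  intros Hp Hn lam D.
  destruct (NB_denom_part_bounds n p Hp Hn) as [HD _]. fold D in HD.
  assert (Hl : 0 < lam) by (apply Rmult_lt_0_compat; [lra|apply pow_lt; lra]).
  assert (Er : r_par n p = lam ^ 2 / D).
  { unfold r_par. fold D. unfold lam. field. lra. }
  assert (Ep : pbar_par n p = D / (lam + D)) by reflexivity.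
  assert (Eq : 1 - pbar_par n p = lam / (lam + D)) by (rewrite Ep; field; lra).
  repeat split.
  - rewrite Er. apply Rdiv_lt_0_compat; [now apply pow_lt|exact HD].
  - rewrite Ep. apply Rdiv_lt_0_compat; lra.
  - assert (0 < lam / (lam + D)) by (apply Rdiv_lt_0_compat; lra). lra.
  - rewrite Eq, Er, Ep. field. lra.
  - rewrite Eq, Er, Ep. field. lra.
  - intros j. rewrite Er, Ep. field. lra.
Qed.

Lemma mass_ratio_succ K : 1 <= K -> exists C, 0 < C /\ forall n p j,
  0 < p -> K * p <= / 100 -> 100 <= INR n * p -> INR j <= K * (INR n * p ^ 2) ->
  Rabs (mass_ratio n p (S j) - mass_ratio n p j)
  <= C * (1 / (INR n * p) + (INR j - INR n * p ^ 2) ^ 2 / (INR n * p) ^ 2)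
     * mass_ratio n p j.
Proof.
  intros HK. destruct (P_S2_succ_ratio K HK) as (C & HC & H).
  exists (2 * (C + 1)). split; [lra|]. intros n p j Hp HKp Hnp Hj.
  specialize (H n p j Hp HKp Hnp Hj).
  assert (Hp1 : p <= / 100) by nra.
  assert (Hn : 10000 <= INR n) by nra.
  destruct (NB_denom_part_bounds n p) as [HD0 HD1]; [lra|lra|].
  destruct (NB_par_facts n p) as (Hr & Hpb & _ & _ & Hc); [lra|lra|].
  specialize (Hc (INR j)). unfold mass_ratio.
  pose proof (NB_succ (r_par n p) (pbar_par n p) j) as Hg.
  rewrite Hc in Hg.
  pose proof (NB_pos (r_par n p) (pbar_par n p) j Hr (proj1 Hpb)) as Hg0.
  assert (Hf : 0 <= P_S2 n p j).
  { rewrite P_S2_blocks. apply cond_pos_sum. intros; apply block_term_nonneg; lra. }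
  set (nn := INR n) in *. set (lam := nn * p ^ 2) in *. set (D := NB_denom_part n p) in *.
  set (f := P_S2 n p j) in *. set (f' := P_S2 n p (S j)) in *.
  set (g := NB _ _ j) in *. set (g' := NB _ _ (S j)) in *.
  set (t := INR j - lam) in *.
  assert (Hl : 0 < lam) by (apply Rmult_lt_0_compat; [lra|apply pow_lt; lra]).
  assert (Hlp : lam = nn * p * p) by (unfold lam; ring).
  assert (HDl : D <= lam) by nra.
  set (c := lam + t * (D / (lam + D))) in *.
  (* This lower bound on the divisor is the source of the factor 2 in the constant. *)
  assert (Hc2 : / 2 * lam <= c).
  { replace c with ((lam ^ 2 + INR j * D) / (lam + D)) by (unfold c, t; field; lra).
    apply (proj1 (Rle_div_r _ _ (lam + D) ltac:(lra))).
    assert (0 <= lam * (lam - D)) by (apply Rmult_le_pos; lra).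
    assert (0 <= INR j * D) by (apply Rmult_le_pos; [apply pos_INR|lra]). nra. }
  set (c0 := lam + t * (p * (2 - 3 * p) / ((1 - p) * (1 + 3 * p)))) in H.
  assert (Ht : Rabs t <= K * lam).
  { apply Rabs_le. unfold t. pose proof (pos_INR j).
    assert (1 * lam <= K * lam) by (apply Rmult_le_compat_r; lra). lra. }
  assert (Hcc : Rabs (c0 - c) <= p).
  { assert (EDl : D = lam * (p * (2 - 3 * p) - 2 * p * (1 - p) / nn)).
    { unfold D, NB_denom_part, lam. fold nn. field. lra. }
    set (d0 := p * (2 - 3 * p)) in *. set (d1 := 2 * p * (1 - p) / nn) in *.
    assert (Hd1 : 0 <= d1 <= 2 * p / nn).
    { unfold d1. split; [apply Rdiv_le_0_compat; nra|]. unfold Rdiv.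
      apply Rmult_le_compat_r; [left; apply Rinv_0_lt_compat; lra|nra]. }
    assert (Hd2 : 0 < d0 - d1) by (apply Rmult_lt_reg_l with lam; lra).
    (* The two slopes are [d0 / (1 + d0)] and [(d0 - d1) / (1 + (d0 - d1))], with [d1] of order
       [p / n]. *)
    replace (c0 - c) with (t * (d1 / ((1 + d0) * (1 + (d0 - d1))))).
    2:{ unfold c0, c. rewrite EDl. fold d0.
        replace ((1 - p) * (1 + 3 * p)) with (1 + d0) by (unfold d0; ring). field.
        split; [lra|split; [|lra]]. apply Rgt_not_eq. nra. }
    rewrite Rabs_mult, (Rabs_pos_eq (d1 / _))
      by (apply Rdiv_le_0_compat; [lra|apply Rmult_lt_0_compat; lra]).
    assert (d1 / ((1 + d0) * (1 + (d0 - d1))) <= 2 * p / nn).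
    { apply Rle_div_l; [apply Rmult_lt_0_compat; lra|].
      assert (1 <= (1 + d0) * (1 + (d0 - d1))) by nra.
      assert (0 <= 2 * p / nn) by lra. nra. }
    apply Rle_trans with (K * lam * (2 * p / nn)).
    - apply Rmult_le_compat; [apply Rabs_pos|apply Rdiv_le_0_compat; [lra|apply Rmult_lt_0_compat; lra]|lra|lra].
    - replace (K * lam * (2 * p / nn)) with (p * (2 * (K * p) * p)) by (unfold lam; field; lra).
      assert (2 * (K * p) * p <= 1) by nra. nra. }
  assert (Hj1 : 0 < INR (S j)) by (apply lt_0_INR; lia).
  assert (Hcp : 0 < c) by lra.
  assert (Eg : g' = g * c / INR (S j)) by (rewrite <- Hg; field; lra).
  assert (Ht2 : 0 <= t ^ 2 / nn) by (apply Rdiv_le_0_compat; [apply pow2_ge_0|lra]).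
  replace (f' / g' - f / g) with (((f' * INR (S j) - f * c0) + f * (c0 - c)) / (g * c)).
  2:{ rewrite Eg. field. lra. }
  unfold Rdiv at 1. rewrite Rabs_mult, (Rabs_pos_eq (/ (g * c)))
    by (left; apply Rinv_0_lt_compat, Rmult_lt_0_compat; lra).
  apply Rle_div_l; [apply Rmult_lt_0_compat; lra|].
  assert (B : Rabs ((f' * INR (S j) - f * c0) + f * (c0 - c)) <= (C + 1) * (p + t ^ 2 / nn) * f).
  { eapply Rle_trans; [apply Rabs_triang|]. rewrite (Rabs_mult f), (Rabs_pos_eq f) by lra.
    assert (f * Rabs (c0 - c) <= f * (p + t ^ 2 / nn)) by (apply Rmult_le_compat_l; lra).
    lra. }
  eapply Rle_trans; [exact B|].
  replace (2 * (C + 1) * (1 / (nn * p) + t ^ 2 / (nn * p) ^ 2) * (f / g) * (g * c))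
    with ((C + 1) * (p + t ^ 2 / nn) * f * (c / (lam / 2))) by (unfold lam; field; lra).
  rewrite <- (Rmult_1_r ((C + 1) * _ * f)) at 1.
  apply Rmult_le_compat_l.
  - apply Rmult_le_pos; [apply Rmult_le_pos; lra|lra].
  - apply Rle_div_r; lra.
Qed.

Lemma slowly_varying_chain rho eps a b : 0 <= eps <= / 2 -> (a <= b)%nat ->
  (forall j, (a <= j < b)%nat -> Rabs (rho (S j) - rho j) <= eps * rho j) ->
  0 < rho a ->
  rho b <= exp (2 * eps * (INR b - INR a)) * rho a /\
  rho a <= exp (2 * eps * (INR b - INR a)) * rho b.
Proof.
  intros He Hab Hs Ha. induction Hab as [|b Hab IH].
  - rewrite Rminus_diag, Rmult_0_r, exp_0. lra.
  - destruct IH as [I1 I2]; [intros; apply Hs; lia|].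
    pose proof (Hs b ltac:(lia)) as Hb. apply Rabs_le_between in Hb.
    rewrite S_INR. replace (2 * eps * (INR b + 1 - INR a))
      with (2 * eps * (INR b - INR a) + 2 * eps) by ring.
    rewrite exp_plus. set (E := exp (2 * eps * (INR b - INR a))) in *.
    assert (HE : 0 < E) by apply exp_pos.
    pose proof (exp_ineq1_le (2 * eps)) as H2. set (e2 := exp (2 * eps)) in *.
    assert (Hrb : 0 < rho b).
    { apply Rmult_lt_reg_l with E; lra. }
    split.
    + apply Rle_trans with (e2 * rho b); [nra|].
      replace (E * e2 * rho a) with (e2 * (E * rho a)) by ring.
      apply Rmult_le_compat_l; lra.
    + apply Rle_trans with (E * rho b); [exact I2|].
      rewrite Rmult_assoc. apply Rmult_le_compat_l; [lra|].
      assert ((1 + 2 * eps) * ((1 - eps) * rho b) <= e2 * rho (S b)).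
      { apply Rmult_le_compat; try lra. apply Rmult_le_pos; lra. }
      (* [(1 + 2 eps) (1 - eps) >= 1] for [eps <= 1/2]: the origin of the 2 in the exponent. *)
      assert (rho b <= (1 + 2 * eps) * ((1 - eps) * rho b)) by nra. lra.
Qed.

(** [w] is the Chebyshev window and [T] a wider range of slow variation that also has to reach [x].
    Over the window, the ratio differs from its value at [x] by a factor of at most [E] either way,
    and both masses lie between [1 - 2 lam / w^2] and 1. *)
Lemma mass_ratio_near_one n p x T w K C eps E :
  0 < p <= / 100 -> 100 <= INR n * p -> K * p ^ 2 <= 1 ->
  let lam := INR n * p ^ 2 in
  (forall j, INR j <= K * lam -> Rabs (mass_ratio n p (S j) - mass_ratio n p j)
     <= C * (1 / (INR n * p) + (INR j - lam) ^ 2 / (INR n * p) ^ 2) * mass_ratio n p j) ->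
  0 < C -> C * (1 / (INR n * p) + T ^ 2 / (INR n * p) ^ 2) <= eps <= / 2 ->
  exp (4 * T * eps) <= E ->
  0 < w <= T -> lam + w <= K * lam -> Rabs (INR x - lam) <= T -> INR x <= K * lam ->
  1 - 2 * lam / w ^ 2 <= E * mass_ratio n p x /\
  (1 - 2 * lam / w ^ 2) * mass_ratio n p x <= E.
Proof.
  intros Hp Hnp HKp lam Hs HC Heps HE Hw HKw Hx HxK.
  assert (Hn : 10000 <= INR n) by nra.
  destruct (NB_denom_part_bounds n p) as [HD0 HD1]; [lra|lra|].
  destruct (NB_par_facts n p) as (Hr & Hpb & Em & Ev & _); [lra|lra|].
  cbv zeta in Em, Ev. fold lam in HD1, Em, Ev.
  assert (Hl : 0 < lam) by (apply Rmult_lt_0_compat; [lra|apply pow_lt; lra]).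
  (* [K p^2 <= 1] means [K lam <= n], so these [j] are attainable counts. *)
  assert (Hfp : forall j, INR j <= K * lam -> 0 < P_S2 n p j).
  { intros j Hj. apply P_S2_pos; [lra|]. apply INR_le.
    assert (K * lam <= INR n).
    { unfold lam. replace (K * (INR n * p ^ 2)) with (INR n * (K * p ^ 2)) by ring.
      rewrite <- (Rmult_1_r (INR n)) at 2. apply Rmult_le_compat_l; lra. }
    lra. }
  set (g := NB (r_par n p) (pbar_par n p)).
  assert (Hg : forall j, 0 < g j) by (intros j; apply NB_pos; tauto).
  assert (Hrho : forall j, INR j <= K * lam -> 0 < mass_ratio n p j).
  { intros j Hj. apply Rdiv_lt_0_compat; [auto|apply Hg]. }
  assert (HT0 : 0 < T) by lra.
  assert (Hy2 : 0 < (INR n * p) ^ 2) by (apply pow_lt; lra).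
  assert (Heps0 : 0 <= eps).
  { eapply Rle_trans; [|apply (proj1 Heps)]. apply Rmult_le_pos; [lra|].
    apply Rplus_le_le_0_compat; apply Rdiv_le_0_compat; try lra. apply pow2_ge_0. }
  assert (Hcmp : forall i j, (i <= j)%nat -> INR j <= K * lam ->
     Rabs (INR i - lam) <= T -> Rabs (INR j - lam) <= T ->
     mass_ratio n p j <= E * mass_ratio n p i /\ mass_ratio n p i <= E * mass_ratio n p j).
  { intros i j Hij HjK Hi Hj. pose proof (le_INR _ _ Hij) as HijR.
    apply Rabs_le_between in Hi. apply Rabs_le_between in Hj.
    destruct (slowly_varying_chain (mass_ratio n p) eps i j) as [A1 A2];
      [lra|exact Hij| |apply Hrho; lra|].
    - intros k [Hk1 Hk2]. apply le_INR in Hk1. apply Nat.lt_le_incl, le_INR in Hk2.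
      assert (HkK : INR k <= K * lam) by lra.
      eapply Rle_trans; [now apply Hs|].
      apply Rmult_le_compat_r; [left; now apply Hrho|].
      eapply Rle_trans; [|apply (proj1 Heps)].
      apply Rmult_le_compat_l; [lra|]. apply Rplus_le_compat_l.
      unfold Rdiv. apply Rmult_le_compat_r; [left; now apply Rinv_0_lt_compat|].
      rewrite <- (pow2_abs (INR k - lam)). apply pow_incr.
      split; [apply Rabs_pos|apply Rabs_le; lra].
    - assert (exp (2 * eps * (INR j - INR i)) <= E).
      (* Two points of the range are at most [2 T] apart. *)
      { eapply Rle_trans; [|exact HE].
        assert (H : 2 * eps * (INR j - INR i) <= 4 * T * eps) by nra.
        destruct H as [H|H]; [left; now apply exp_increasing|right; now rewrite H]. }
      assert (0 < mass_ratio n p i) by (apply Hrho; lra).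
      assert (0 < mass_ratio n p j) by now apply Hrho.
      split; [apply (Rle_trans _ _ _ A1)|apply (Rle_trans _ _ _ A2)];
        apply Rmult_le_compat_r; lra. }
  assert (Hcx : forall j, Rabs (INR j - lam) <= w ->
     mass_ratio n p j <= E * mass_ratio n p x /\ mass_ratio n p x <= E * mass_ratio n p j).
  { intros j Hj. assert (INR j <= K * lam) by (apply Rabs_le_between in Hj; lra).
    assert (Rabs (INR j - lam) <= T) by lra.
    destruct (Nat.le_ge_cases x j); [apply Hcmp|apply and_comm, Hcmp]; auto. }
  destruct (INR_unbounded (lam + w)) as [J HJ].
  assert (HJw : forall j, Rabs (INR j - lam) <= w -> (j <= J)%nat).
  { intros j Hj. apply Rabs_le_between in Hj. apply INR_le. lra. }
  assert (Hn1 : (1 <= n)%nat) by (apply INR_le; simpl; lra).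
  destruct (chebyshev_window (P_S2 n p) lam (lam + NB_denom_part n p) w J) as [F1 F2];
    [|apply P_S2_series|now apply P_S2_variance|lra|exact HJw|].
  { intros j. rewrite P_S2_blocks. apply cond_pos_sum. intros; apply block_term_nonneg; lra. }
  destruct (chebyshev_window g lam (lam + NB_denom_part n p) w J) as [G1 G2];
    [intros; left; apply Hg|now apply NB_series| |lra|exact HJw|].
  { rewrite <- Ev, <- Em. now apply NB_variance. }
  fold lam in F1.
  set (V := lam + NB_denom_part n p) in *.
  assert (HV : 1 - 2 * lam / w ^ 2 <= 1 - V / w ^ 2).
  { apply Rplus_le_compat_l, Ropp_le_contravar. unfold Rdiv. apply Rmult_le_compat_r.
    - left. apply Rinv_0_lt_compat, pow_lt. lra.
    - unfold V. nra. }
  set (wf := sum_f_R0 _ J) in F1, F2. set (wg := sum_f_R0 _ J) in G1, G2.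
  assert (HE0 : 0 < E) by (eapply Rlt_le_trans; [apply exp_pos|exact HE]).
  pose proof (Hrho x HxK) as Hrx.
  assert (Ef : forall j, P_S2 n p j = mass_ratio n p j * g j).
  { intros j. unfold mass_ratio. fold g. specialize (Hg j). field. lra. }
  assert (W1 : wf <= E * mass_ratio n p x * wg).
  { unfold wf, wg. rewrite <- sum_scal_l. apply sum_Rle. intros j _.
    destruct (Rle_dec _ w) as [Hj|_]; [|lra]. rewrite Ef.
    apply Rmult_le_compat_r; [left; apply Hg|now apply Hcx]. }
  assert (W2 : mass_ratio n p x * wg <= E * wf).
  { unfold wf, wg. rewrite <- !sum_scal_l. apply sum_Rle. intros j _.
    destruct (Rle_dec _ w) as [Hj|_]; [|lra]. rewrite Ef, <- Rmult_assoc.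
    apply Rmult_le_compat_r; [left; apply Hg|now apply Hcx]. }
  split.
  - assert (E * mass_ratio n p x * wg <= E * mass_ratio n p x * 1).
    { apply Rmult_le_compat_l; [|exact G2]. apply Rmult_le_pos; lra. }
    lra.
  - assert (E * wf <= E * 1) by (apply Rmult_le_compat_l; lra).
    assert (mass_ratio n p x * (1 - 2 * lam / w ^ 2) <= mass_ratio n p x * wg)
      by (apply Rmult_le_compat_l; lra).
    lra.
Qed.

(** * Choice of the window and conclusion *)

Theorem theorem3 (p : nat -> R) (x : nat -> nat)
  (Hp : forall n, 0 < p n < 1)
  (Hp0 : Un_cv p 0)
  (Hnp : cv_infty (fun n => INR n * p n))
  (Hx : forall eps, eps > 0 -> exists N, forall n, (n >= N)%nat ->
          Rabs (INR (x n) - INR n * p n ^ 2)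
          <= eps * Rmin (INR n * p n ^ 2) (Rpower (INR n * p n) (2 / 3))) :
  Un_cv (fun n => P_S2 n (p n) (x n) / NB (r_par n (p n)) (pbar_par n (p n)) (x n)) 1.
Proof.
  intros tau Htau.
  (* The ratio will lie between [(1 - a) / (1 + a)] and [(1 + a) / (1 - a)]; the 8 puts both within
     [tau] of 1. *)
  set (a := Rmin tau 1 / 8).
  assert (Ha : 0 < a <= / 8 /\ 8 * a <= tau).
  { unfold a. pose proof (Rmin_l tau 1). pose proof (Rmin_r tau 1).
    assert (0 < Rmin tau 1) by (apply Rmin_glb_lt; lra). lra. }
  (* The window will have [w^2 = 2 lam / a], and [w <= (4 / a) lam] then follows from [lam >= 1/2]
     and [a <= 1/8]. *)
  set (K := 1 + 4 / a).
  assert (HK0 : 0 < 4 / a) by (apply Rdiv_lt_0_compat; lra).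
  assert (HK : 1 <= K) by (unfold K; lra).
  destruct (mass_ratio_succ K HK) as (C & HC & Hstep).
  (* For [T = e0 Y], [C e0 <= a / 16] will make the exponent [4 T eps] at most [a / 2]. *)
  set (e0 := Rmin (/ 2) (a / (16 * C))).
  assert (He0 : 0 < e0 <= / 2 /\ C * e0 <= a / 16).
  { unfold e0. pose proof (Rmin_l (/ 2) (a / (16 * C))).
    pose proof (Rmin_r (/ 2) (a / (16 * C))) as H2.
    assert (0 < a / (16 * C)) by (apply Rdiv_lt_0_compat; lra).
    assert (0 < Rmin (/ 2) (a / (16 * C))) by (apply Rmin_glb_lt; lra).
    split; [lra|].
    apply (Rmult_le_compat_l C) in H2; [|lra].
    replace (C * (a / (16 * C))) with (a / 16) in H2 by (field; lra). exact H2. }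
  destruct (Hx e0) as [N1 HN1]; [lra|].
  (* The second bound fits the window into the range: [w^2 = 2 y q / a <= e0^2 y <= (e0 Y)^2], using
     [y <= Y^2]. *)
  set (p1 := Rmin (/ (100 * K)) (a * e0 ^ 2 / 2)).
  assert (He2 : 0 < a * e0 ^ 2 / 2).
  { apply Rdiv_lt_0_compat; [|lra]. apply Rmult_lt_0_compat; [lra|apply pow_lt; lra]. }
  assert (Hp1 : 0 < p1).
  { apply Rmin_glb_lt; [apply Rinv_0_lt_compat; lra|exact He2]. }
  destruct (Hp0 p1 Hp1) as [N2 HN2].
  destruct (Hnp (Rmax 100 (4 * C))) as [N3 HN3].
  exists (N1 + N2 + N3)%nat. intros n Hn.
  specialize (HN1 n ltac:(lia)). specialize (HN2 n ltac:(lia)). specialize (HN3 n ltac:(lia)).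
  specialize (Hp n). unfold Rdist in *. rewrite Rminus_0_r, Rabs_pos_eq in HN2 by lra.
  fold (mass_ratio n (p n) (x n)).
  set (q := p n) in *. set (y := INR n * q) in *. set (lam := INR n * q ^ 2) in *.
  set (Y := Rpower y (2 / 3)) in *.
  assert (Hq1 : q <= / (100 * K)) by (pose proof (Rmin_l (/ (100 * K)) (a * e0 ^ 2 / 2)); unfold p1 in HN2; lra).
  assert (Hq2 : q <= a * e0 ^ 2 / 2) by (pose proof (Rmin_r (/ (100 * K)) (a * e0 ^ 2 / 2)); unfold p1 in HN2; lra).
  assert (HKq : K * q <= / 100).
  { apply (Rmult_le_compat_l K) in Hq1; [|lra].
    replace (K * / (100 * K)) with (/ 100) in Hq1 by (field; lra). exact Hq1. }
  assert (Hq100 : q <= / 100) by nra.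
  assert (Hy : 100 <= y) by (pose proof (Rmax_l 100 (4 * C)); lra).
  assert (HyC : 4 * C <= y) by (pose proof (Rmax_r 100 (4 * C)); lra).
  assert (HY0 : 0 < Y) by apply exp_pos.
  assert (HY3 : Y ^ 3 = y ^ 2).
  { unfold Y. rewrite <- Rpower_pow, Rpower_mult by apply exp_pos.
    rewrite <- (Rpower_pow 2 y) by lra. f_equal. simpl. field. }
  assert (HYy : Y <= y).
  { unfold Y. rewrite <- (Rpower_1 y) at 2 by lra. apply Rle_Rpower; lra. }
  assert (HYy2 : y <= Y ^ 2).
  { unfold Y. rewrite <- Rpower_pow, Rpower_mult by apply exp_pos.
    rewrite <- (Rpower_1 y) at 1 by lra. apply Rle_Rpower; [lra|]. simpl. lra. }
  assert (Hly : lam = y * q) by (unfold lam, y; ring).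
  assert (Hl : 0 < lam) by (rewrite Hly; apply Rmult_lt_0_compat; lra).
  (* The two parts of the minimum serve different ends: [lam] makes [x n] comparable to [lam], [Y]
     keeps it in the range of slow variation. *)
  pose proof (Rmin_l lam Y) as M1. pose proof (Rmin_r lam Y) as M2.
  assert (X1 : Rabs (INR (x n) - lam) <= e0 * lam).
  { eapply Rle_trans; [exact HN1|]. apply Rmult_le_compat_l; lra. }
  assert (X2 : Rabs (INR (x n) - lam) <= e0 * Y).
  { eapply Rle_trans; [exact HN1|]. apply Rmult_le_compat_l; lra. }
  assert (X3 : / 2 * lam <= INR (x n) <= 2 * lam) by (apply Rabs_le_between in X1; clear - X1 He0 Hl; nra).
  (* The relative closeness to [lam] makes [x n] a positive integer, so [lam]
     cannot tend to [0] and the window width is at most a multiple of [lam]. *)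
  assert (Hl2 : / 2 <= lam).
  { destruct (x n) as [|m]; [simpl in X3; lra|].
    rewrite S_INR in X3. pose proof (pos_INR m). lra. }
  set (w := sqrt (2 * lam / a)).
  assert (Hw2 : w ^ 2 = 2 * lam / a) by (apply pow2_sqrt, Rdiv_le_0_compat; lra).
  assert (Hw0 : 0 < w) by (apply sqrt_lt_R0, Rdiv_lt_0_compat; lra).
  assert (HwT : w <= e0 * Y).
  { apply Rsqr_incr_0; [|lra|nra]. rewrite !Rsqr_pow2, Hw2. apply Rle_div_l; [lra|].
    assert (y * (2 * q) <= Y ^ 2 * (a * e0 ^ 2)) by (apply Rmult_le_compat; lra).
    rewrite Hly. lra. }
  assert (HwK : lam + w <= K * lam).
  { replace (K * lam) with (lam + 4 / a * lam) by (unfold K; ring).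
    apply Rplus_le_compat_l. apply Rsqr_incr_0; [|lra|nra].
    rewrite !Rsqr_pow2, Hw2.
    replace ((4 / a * lam) ^ 2) with (2 * lam / a * (8 * lam / a)) by (field; lra).
    rewrite <- (Rmult_1_r (2 * lam / a)) at 1.
    apply Rmult_le_compat_l; [apply Rdiv_le_0_compat; lra|].
    apply Rle_div_r; lra. }
  set (T := e0 * Y) in *.
  set (eps := C * (1 / y + T ^ 2 / y ^ 2)).
  assert (Hy1 : C * (1 / y) <= / 4).
  { replace (C * (1 / y)) with (C / y) by (field; lra). apply Rle_div_l; lra. }
  assert (HTy : T ^ 2 / y ^ 2 <= e0 ^ 2).
  { apply Rle_div_l; [apply pow_lt; lra|]. unfold T. rewrite Rpow_mult_distr.
    apply Rmult_le_compat_l; [apply pow2_ge_0|]. apply pow_incr. lra. }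
  assert (Heps : eps <= / 2).
  { unfold eps. rewrite Rmult_plus_distr_l.
    assert (C * (T ^ 2 / y ^ 2) <= C * e0 * e0).
    { replace (C * e0 * e0) with (C * e0 ^ 2) by ring. apply Rmult_le_compat_l; lra. }
    assert (C * e0 * e0 <= a / 16 * / 2) by (clear - He0 HC; apply Rmult_le_compat; nra). lra. }
  assert (HTe : 4 * T * eps <= a / 2).
  (* The cubic part is a constant times [Y^3 / y^2], which equals 1: the exponent 2/3 is the largest
     that keeps it bounded. *)
  { replace (4 * T * eps) with (4 * (C * e0) * (Y / y + e0 ^ 2 * (Y ^ 3 / y ^ 2)))
      by (unfold eps, T; field; lra).
    rewrite HY3. replace (y ^ 2 / y ^ 2) with 1 by (field; lra).
    assert (0 <= Y / y <= 1) by (split; [apply Rdiv_le_0_compat; lra|apply Rle_div_l; lra]).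
    assert (0 <= e0 ^ 2 <= 1) by (clear - He0; nra).
    assert (4 * (C * e0) * (Y / y + e0 ^ 2 * 1) <= 4 * (a / 16) * 2).
    { apply Rmult_le_compat; try lra. clear - He0 HC. nra. }
    lra. }
  assert (HE : exp (4 * T * eps) <= 1 + a).
  (* [exp (- z) >= 1 - z] yields the upper bound [1 / (1 - a / 2)] for [exp z]. *)
  { assert (H1 : (1 - a / 2) * exp (4 * T * eps) <= 1).
    { apply Rle_trans with (exp (- (4 * T * eps)) * exp (4 * T * eps)).
      - apply Rmult_le_compat_r; [left; apply exp_pos|].
        pose proof (exp_ineq1_le (- (4 * T * eps))). lra.
      - rewrite <- exp_plus, Rplus_opp_l, exp_0. lra. }
    assert (1 <= (1 - a / 2) * (1 + a)) by (clear - Ha; nra).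
    apply Rmult_le_reg_l with (1 - a / 2); lra. }
  destruct (mass_ratio_near_one n q (x n) T w K C eps (1 + a)) as [R1 R2];
    try assumption; try lra.
  - clear - HKq Hq100 Hp HK. nra.
  - intros j Hj. apply Hstep; [lra|exact HKq|exact Hy|exact Hj].
  - fold y. unfold eps in *. lra.
  - fold lam. assert (1 <= 4 / a) by (apply Rle_div_r; lra). unfold K. clear - H X3 Hl. nra.
  - fold lam in R1, R2.
    assert (Ew : 2 * lam / w ^ 2 = a) by (rewrite Hw2; field; lra).
    rewrite Ew in R1, R2.
    set (rho := mass_ratio n q (x n)) in *.
    clear - R1 R2 Ha. apply Rabs_def1; nra.
Qed.
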